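(* Let $\beta\in(0,1)^J$ be a weight vector ($J\ge2$, $\sum_{i\in\mathcal I}\beta_i=1$), let $\overline\Gamma$ be the associated GPS extended Skorokhod map, let $\psi\in\mathcal D([0,\infty):\mathbb R^J)$ with $\psi(0)\in\mathbb R_+^J$, let $\varphi=\overline\Gamma(\psi)$, and for $t\in[0,\infty)$ let $E(t)=\{i\in\mathcal I:\varphi_i(t)=0\}$. Moreover, suppose there exist $0\le T_0<T<\infty$ and $\mathcal S\subsetneq\mathcal I$ such that $\mathcal S\subseteq E(t)$ for every $t\in[T_0,T)$. Then, if $\mathcal K=\mathcal I\setminus\mathcal S$, the vector-valued process $\varphi^{\mathcal K}=\{\varphi_i,\ i\in\mathcal K\}$ satisfies $$\varphi^{\mathcal K}(t)=\overline\Gamma^{\mathcal K}(\psi^{\mathcal K})(t)\qquad\text{for } t\in[T_0,T),$$ where $\overline\Gamma^{\mathcal K}$ is the $\mathcal K$-reduced GPS extended Skorokhod map, i.e. the one on the index set $\mathcal K$ with weights $\beta_i^{\mathcal K}=\beta_i/\sum_{k\in\mathcal K}\beta_k$, $i\in\mathcal K$, and $\psi^{\mathcal K}=\{\psi_i^{\mathcal K},\ i\in\mathcal K\}$ is given by $$\psi_i^{\mathcal K}=\psi_i+\beta_i^{\mathcal K}\Big(\sum_{j\in\mathcal S}\psi_j\Big)\qquad\text{for } i\in\mathcal K.$$ Finally, if $\psi\in\mathrm{dom}(\Gamma)$, where $\Gamma$ is the GPS Skorokhod map associated with $\beta$, then $\varphi^{\mathcal K}=\Gamma^{\mathcal K}(\psi^{\mathcal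 K})$, where $\Gamma^{\mathcal K}$ is the $\mathcal K$-reduced GPS Skorokhod map.
   Context: $\mathcal I=\{1,\dots,J\}$; $\mathcal D([0,\infty):\mathbb R^J)$ is the space of right-continuous functions on $[0,\infty)$ with left limits, with values in $\mathbb R^J$; $|\eta|(t)$ is the total variation of $\eta$ on $[0,t]$ with respect to the Euclidean norm. **GPS Skorokhod problem (SP) and extended Skorokhod problem (ESP) on an index set.** (GPS stands for generalized processor sharing.) Let $A$ be a nonempty finite set with weights $b\in(0,1]^A$, $\sum_{i\in A}b_i=1$; $(e_i)_{i\in A}$ is the standard basis of $\mathbb R^A$. Put $d_i=e_i-\sum_{j\in A\setminus\{i\}}\frac{b_j}{1-b_i}e_j$ for $i\in A$ (the sum is empty when $A=\{i\}$), and $d_*=\sum_{i\in A}e_i/\sqrt{|A|}$. For $x\in\mathbb R_+^A$, $d(x)=\{\sum_{i:x_i=0}a_id_i:a_i\ge0\}$ if $x\ne0$, and $d(0)=\{\sum_{i\in A}a_id_i+a_*d_*:a_i,a_*\ge0\}$. Let $\psi\in\mathcal D([0,\infty):\mathbb R^A)$ with $\psi(0)\in\mathbb R^A_+$. - ESP: $(\varphi,\eta)$ solves the GPS ESP for $\psi$ if $\varphi(0)=\psi(0)$ and for all $t\ge0$: $\varphi(t)=\psi(t)+\eta(t)$; $\varphi(t)\in\mathbb R_+^A$; for every $s\in[0,t]$, $\eta(t)-\eta(s)\in\overline{\mathrm{co}}[\bigcup_{u\in(s,t]}d(\varphi(u))]$ (closure of the convex hull); and $\eta(t)-\eta(t-)\in\overline{\mathrm{co}}[d(\varphi(t))]$.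 There is a unique solution for every such $\psi$, and the GPS extended Skorokhod map sends $\psi$ to $\varphi$. - SP: $(\varphi,\eta)$ solves the GPS SP for $\psi$ if $\varphi(0)=\psi(0)$ and for all $t\ge0$: $\varphi(t)=\psi(t)+\eta(t)$; $\varphi(t)\in\mathbb R_+^A$; $|\eta|(t)<\infty$; $|\eta|(t)=\int_{[0,t]}1_{\{\varphi(s)\in\partial\mathbb R_+^A\}}\,d|\eta|(s)$; and there is a measurable $g:[0,\infty)\to\mathbb R^A$ with $g(s)\in d(\varphi(s))$ and $|g(s)|=1$ for $d|\eta|$-almost every $s$, and $\eta(t)=\int_{[0,t]}g(s)\,d|\eta|(s)$. The GPS Skorokhod map sends $\psi$ to $\varphi$ (solutions are unique when they exist); its domain $\mathrm{dom}$ is the set of $\psi$ for which a solution exists. $\Gamma,\overline\Gamma$ denote the Skorokhod and extended Skorokhod maps for $A=\mathcal I$, $b=\beta$; $\Gamma^{\mathcal K},\overline\Gamma^{\mathcal K}$ those for $A=\mathcal K$, $b=\beta^{\mathcal K}=(\beta_i^{\mathcal K})_{i\in\mathcal K}$.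
   Formalization: For T0>0 the equation as written can fail (J≥3), so the reduced maps are restarted at T0: φ^K(t) = Γ̄^K(φ^K(T0)+ψ^K(T0+·)−ψ^K(T0))(t−T0) on [T0,T), and likewise for Γ^K when ψ∈dom(Γ); for T0=0 this is the stated equation. *)

(* Defs.v *)
From HB Require Import structures.
From mathcomp Require Import all_boot all_order all_algebra.
From mathcomp Require Import all_classical all_reals all_analysis.
Import Order.TTheory GRing.Theory Num.Theory.
Import numFieldNormedType.Exports.

Set Implicit Arguments.
Unset Strict Implicit.
Unset Printing Implicit Defensive.

Local Open Scope classical_set_scope.
Local Open Scope ring_scope.

(* Vectors of R^A are functions A -> R.  A path on [0, oo) is a function on all
   of R whose values at negative times are never used. *)

Section Vectors.
Variables (R : realType) (A : finType).

Definition enorm (x : A -> R) : R := Num.sqrt (\sum_i x i ^+ 2).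

Definition orthant : set (A -> R) := [set x | forall i, 0 <= x i].

(* {ptws A -> R} carries the product topology, i.e. the Euclidean one, A being
   finite. *)
Definition orthant_boundary : set (A -> R) :=
  @closure {ptws A -> R} orthant `\` @interior {ptws A -> R} orthant.

(* In particular the convex hull of the empty set is empty. *)
Definition convex_hull (C : set (A -> R)) : set (A -> R) :=
  [set y | exists n (l : 'I_n -> R) (z : 'I_n -> A -> R),
    [/\ forall k, 0 <= l k, \sum_k l k = 1, forall k, C (z k) &
        forall i, y i = \sum_k l k * z k i]].

Definition closed_convex_hull (C : set (A -> R)) : set (A -> R) :=
  @closure {ptws A -> R} (convex_hull C).

Definition cadlag (f : R -> A -> R) : Prop :=
  (forall (t : R) i, 0 <= t -> f u i @[u --> t^'+] --> f t i) /\
  (forall (t : R) i, 0 < t -> cvg (f u i @[u --> t^'-])).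

Definition left_limit (f : R -> A -> R) (t : R) : A -> R :=
  fun i => lim (f u i @[u --> t^'-]).

Definition vec_variation (f : R -> A -> R) (t : R) (l : seq R) : R :=
  let F := f \o nth t (0 :: l) in
  \sum_(0 <= n < size l) enorm (fun i => F n.+1 i - F n i).

Definition vec_total_variation (f : R -> A -> R) (t : R) : \bar R :=
  ereal_sup [set (vec_variation f t l)%:E | l in itv_partition 0 t].

End Vectors.

Section GPS.
Variables (R : realType) (A : finType) (b : A -> R).

Definition gps_dir (i : A) : A -> R :=
  fun j => if j == i then 1 else - (b j / (1 - b i)).

Definition gps_dir_origin : A -> R := fun _ => (Num.sqrt #|A|%:R)^-1.

Definition gps_cone (x : A -> R) : set (A -> R) :=
  [set y | exists (a : A -> R) (a0 : R),
    [/\ forall i, 0 <= a i, 0 <= a0, ((exists i, x i != 0) -> a0 = 0) &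
        forall j, y j = \sum_(i | x i == 0) a i * gps_dir i j
                        + a0 * gps_dir_origin j]].

(* The increment condition is required for s < t only: at s = t the union of
   cones over ]t, t] is empty, and so is its convex hull.  The jump condition
   at time 0 is void since eta 0 = 0, with the convention eta(0-) = 0. *)
Definition gps_ESP (psi phi eta : R -> A -> R) : Prop :=
  [/\ cadlag phi, cadlag eta, (forall i, phi 0 i = psi 0 i) &
    forall t : R, 0 <= t ->
    [/\ forall i, phi t i = psi t i + eta t i,
        orthant (phi t),
        forall s : R, 0 <= s < t ->
          closed_convex_hull (\bigcup_(u in `]s, t]) gps_cone (phi u))
            (fun i => eta t i - eta s i) &
        0 < t -> closed_convex_hull (gps_cone (phi t))
            (fun i => eta t i - left_limit eta t i)]].

(* v is the cumulative function t |-> |eta|(t) of the measure d|eta|, extended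
   by 0 to negative times; requiring its values to be real numbers is the
   finiteness of the total variation. *)
Definition gps_SP (psi phi eta : R -> A -> R) : Prop :=
  [/\ cadlag phi, cadlag eta, (forall i, phi 0 i = psi 0 i),
    (forall t : R, 0 <= t ->
      (forall i, phi t i = psi t i + eta t i) /\ orthant (phi t)) &
    exists v : cumulative R R,
      [/\ forall t : R, t < 0 -> v t = 0,
          forall t : R, 0 <= t -> vec_total_variation eta t = (v t)%:E,
          forall t : R, 0 <= t -> (v t)%:E =
            (\int[lebesgue_stieltjes_measure v]_(s in `[0%R, t])
               (\1_[set s | orthant_boundary (phi s)] s)%:E)%E &
          exists g : R -> A -> R,
          [/\ forall i, measurable_fun (`[0, +oo[ : set R) (fun s : R => g s i),
              {ae lebesgue_stieltjes_measure v, forall s : R, 0 <= s ->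
                 gps_cone (phi s) (g s) /\ enorm (g s) = 1} &
              forall (t : R) i, 0 <= t -> (eta t i)%:E =
                (\int[lebesgue_stieltjes_measure v]_(s in `[0%R, t])
                   (g s i)%:E)%E]]].

(* Graphs of the extended Skorokhod map and of the Skorokhod map. *)
Definition gps_ESM (psi phi : R -> A -> R) : Prop :=
  exists eta, gps_ESP psi phi eta.

Definition gps_SM (psi phi : R -> A -> R) : Prop :=
  exists eta, gps_SP psi phi eta.

Definition gps_SM_dom (psi : R -> A -> R) : Prop := exists phi, gps_SM psi phi.

End GPS.

Section Reduced.
Variables (R : realType) (J : nat) (S : {set 'I_J}).

(* The index set K = I \ S. *)
Definition rest := {i : 'I_J | i \notin S}.

Definition weightK (beta : 'I_J -> R) : rest -> R :=
  fun i => beta (val i) / \sum_(k in ~: S) beta k.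

Definition pathK (beta : 'I_J -> R) (psi : R -> 'I_J -> R) : R -> rest -> R :=
  fun t i => psi t (val i) + weightK beta i * \sum_(j in S) psi t j.

Definition restrictK (phi : R -> 'I_J -> R) : R -> rest -> R :=
  fun t i => phi t (val i).

End Reduced.

Arguments weightK {R J} S beta _.
Arguments pathK {R J} S beta psi _ _.
Arguments restrictK {R J} S phi _ _.

(* The input path psi restarted at time T0 from the state x.  A Skorokhod map
   depends on the whole past of its input, and before T0 the reduced problem
   need not track phi; hence the equation phi^K = Gamma^K(psi^K) on [T0, T) is
   about the reduced map started at T0 from phi^K(T0) and driven by the
   increments of psi^K.  Without the restart it fails for T0 > 0, J >= 3. *)
Definition restart (R : realType) (A : finType) (T0 : R) (x : A -> R)
    (psi : R -> A -> R) : R -> A -> R :=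
  fun u i => x i + (psi (T0 + u) i - psi T0 i).

(* For T0 = 0, the restarted input of the K-reduced problem is psi^K itself. *)
Lemma restart0 (R : realType) (J : nat) (S : {set 'I_J}) (beta : 'I_J -> R)
    (psi phi : R -> 'I_J -> R) :
  gps_ESM beta psi phi -> (forall i, i \in S -> phi 0 i = 0) ->
  restart 0 (restrictK S phi 0) (pathK S beta psi) = pathK S beta psi.
Proof.
move=> [eta [_ _ phi0 _]] phiS; apply/funext => u; apply/funext => i.
have s0 : \sum_(j in S) psi 0 j = 0.
  by apply: big1 => j /phiS; rewrite phi0.
by rewrite /restart add0r /restrictK phi0 /pathK s0 mulr0 addr0 addrC subrK.
Qed.

(* Main.v *)
(** A vector [w] is nonpositive on the cone [d(x)] as soon as [w i] is at most the
    [b]-average of [w] whenever [x i = 0], and [w <= 0] if [x = 0].  The l1-norm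
    has at [x - y] a subgradient [w] such that [w] has this property at [x] and
    [- w] has it at [y].  Testing increments of the constraining terms over short
    intervals to the left of a time, and jumps, against it shows that the
    l1-distance of two solutions with the same input is nonincreasing: uniqueness
    holds without any bounded variation.  A test vector of the reduced problem,
    extended to [S] by its average, is a test vector of the full problem at every
    state vanishing on [S]; this gives the first assertion.

    For the second one the reduced Skorokhod problem has to be solved on the whole
    half-line, where [phi] need not vanish on [S].  Put [L = sum_j eta_j], which
    only grows when [phi = 0].  A solution is given by the running suprema
    [m_i(t) = sup_(s <= t) (b_i X(s) - psi_i(s))^+] where [X] solves the equation
    [X = sum_i m_i - L], whose right-hand side is monotone in [X].  A large multiple
    of the total variation of [eta] is a supersolution and [- L] a subsolution, so
    the Knaster-Tarski theorem applies.  The direction field is the density of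
    the regulator with respect to its total variation measure. *)

Require Import Defs.
From HB Require Import structures.
From mathcomp Require Import all_boot all_order all_algebra.
From mathcomp Require Import all_classical all_reals all_analysis.
From mathcomp Require Import measurable_realfun.
From mathcomp Require Import ring lra.
Import Order.TTheory GRing.Theory Num.Theory.
Import numFieldNormedType.Exports.
Local Open Scope classical_set_scope.
Local Open Scope ring_scope.

Set Implicit Arguments.
Unset Strict Implicit.
Unset Printing Implicit Defensive.

(** * The polar of the cone of directions *)

(** The extended problem and the Skorokhod problem are never converted into each other: both imply
    the same half-space conditions on increments and jumps, and uniqueness is proved for these.
    Hence a path of one problem can be compared with a path of the other. The equation for [X] comes
    from writing the regulator as [m_i - b_i X], [m_i] being the running suprema: up to a factor
    [d_i] is [e_i - b], so a push raises one coordinate and lowers all of them in proportion to [b].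
    The coordinates of the regulator must sum to [L], which forces [X = sum_i m_i - L]. The input
    [L] received at the origin is not free, as it may only grow while the solution is 0. It is
    inherited from the full problem: the reduced weights sum to 1, so from [T0] on the reduced
    solution and the full one have the same sum of coordinates. Both being nonnegative, they are at
    the origin at the same times, even after [T]. An order-theoretic fixed point need not be
    right-continuous; this is why the greatest one is taken. *)

Lemma cvg_sumr {R : realType} {I : Type} (r : seq I) (P : pred I) {T : Type}
    (F : set_system T) (f : I -> T -> R) (l : I -> R) : Filter F ->
  (forall i, P i -> f i x @[x --> F] --> l i) ->
  (\sum_(i <- r | P i) f i x) @[x --> F] --> \sum_(i <- r | P i) l i.
Proof.
move=> FF fl; elim: r => [|i r IH].
  by rewrite big_nil; under eq_cvg do rewrite big_nil; exact: cvg_cst.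
rewrite big_cons; under eq_cvg do rewrite big_cons.
by case: ifPn => // Pi; apply: cvgD => //; exact: fl.
Qed.

Section Polar.
Context {R : realType} {A : finType}.
Implicit Types b w x y : A -> R.

Definition dotp w y : R := \sum_i w i * y i.

Lemma dotpDr w y z : dotp w (fun i => y i + z i) = dotp w y + dotp w z.
Proof. by rewrite /dotp -big_split; apply: eq_bigr => i _; rewrite mulrDr. Qed.

Lemma dotpNr w y : dotp w (fun i => - y i) = - dotp w y.
Proof. by rewrite /dotp -sumrN; apply: eq_bigr => i _; rewrite mulrN. Qed.

Lemma dotpBr w y z : dotp w (fun i => y i - z i) = dotp w y - dotp w z.
Proof. by rewrite dotpDr dotpNr. Qed.

Lemma dotpNl w y : dotp (fun i => - w i) y = - dotp w y.
Proof. by rewrite /dotp -sumrN; apply: eq_bigr => i _; rewrite mulNr. Qed.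

Lemma dotp_continuous w (y : {ptws A -> R}) : dotp w z @[z --> y] --> dotp w y.
Proof.
have H i : w i * z i @[z --> y] --> w i * y i.
  have P : (fun z : {ptws A -> R} => z i : R) @ y --> (y i : R).
    exact: (@proj_continuous A (fun=> R) i y).
  exact: (@cvgM R {ptws A -> R} (nbhs y) _ (fun=> w i) _ (w i) (y i) (cvg_cst _) P).
exact: (@cvg_sumr R A (index_enum A) xpredT {ptws A -> R} (nbhs y)
  (fun i z => w i * z i) (fun i => w i * y i) _ (fun i _ => H i)).
Qed.

Lemma closed_convex_hull_halfspace (C : set (A -> R)) w y :
  (forall z, C z -> dotp w z <= 0) -> closed_convex_hull C y -> dotp w y <= 0.
Proof.
move=> Cw; rewrite leNgt => Cy; apply/negP => wy0.
have : nbhs (y : {ptws A -> R}) [set z : {ptws A -> R} | 0 < dotp w z].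
  exact: (dotp_continuous (lt_nbhsr wy0)).
move=> /Cy[z [[n [l [v [l0 _ Cv zE]]]]]] /=; apply/negP; rewrite -leNgt.
have -> : dotp w z = \sum_k l k * dotp w (v k).
  rewrite /dotp; under eq_bigr do rewrite zE mulr_sumr.
  rewrite exchange_big; apply: eq_bigr => k _; rewrite mulr_sumr.
  by apply: eq_bigr => i _; rewrite mulrCA.
by apply: sumr_le0 => k _; rewrite mulr_ge0_le0 // Cw.
Qed.

(* The polar cone of [gps_cone b x]: [w . d_i <= 0] iff [w i] is at most the
   [b]-average of [w], because [d_i] is the multiple of [e_i - b] by
   [1 / (1 - b i)]. *)
Definition polar_dir b w x : Prop :=
  (forall i, x i = 0 -> w i <= dotp b w) /\
  ((forall i, x i = 0) -> forall i, w i <= 0).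

(** The index set [rest S] may be a single point. Then the weight is 1 and the factor
    [1 / (1 - b i)] degenerates, so this case is treated apart. *)
Lemma weight_eq1 b j : (forall i, 0 < b i) -> \sum_i b i = 1 -> b j = 1 ->
  forall k, k = j.
Proof.
move=> b0; rewrite (bigD1 j) //= => + bj1 k; rewrite bj1.
rewrite -[RHS]addr0 => /addrI S0.
apply/eqP/negP => /negP kj; suff : 0 < 0 :> R by rewrite ltxx.
rewrite -[X in _ < X]S0 (bigD1 k) //=.
by rewrite ltr_pwDl // sumr_ge0 // => l _; exact: ltW.
Qed.

Lemma weight_le1 b j : (forall i, 0 < b i) -> \sum_i b i = 1 -> b j <= 1.
Proof.
by move=> b0 <-; rewrite (bigD1 j) //= lerDl sumr_ge0 // => k _; exact: ltW.
Qed.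

Lemma dotp_gps_dir b w j : b j != 1 ->
  dotp w (gps_dir b j) = (w j - dotp b w) / (1 - b j).
Proof.
move=> bj1; rewrite /dotp (bigD1 j) //= /gps_dir eqxx mulr1.
rewrite [X in w j - X](bigD1 j) //=.
under eq_bigr => k kj do rewrite (negbTE kj) mulrN mulrA.
rewrite sumrN -mulr_suml; under eq_bigr do rewrite mulrC.
by field; rewrite subr_eq0 eq_sym.
Qed.

Lemma gps_cone_polar b w x y : (forall i, 0 < b i) -> \sum_i b i = 1 ->
  polar_dir b w x -> gps_cone b x y -> dotp w y <= 0.
Proof.
move=> b0 b1 [w1 w2] [a [a0 [age a0ge a0E yE]]].
have -> : dotp w y = \sum_(i | x i == 0) a i * dotp w (gps_dir b i) +
    a0 * (Num.sqrt #|A|%:R)^-1 * \sum_i w i.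
  rewrite /dotp; under eq_bigr do rewrite yE mulrDr mulr_sumr.
  rewrite big_split /= exchange_big /= mulr_sumr; congr (_ + _).
    apply: eq_bigr => i _; rewrite mulr_sumr.
    by apply: eq_bigr => j _; rewrite mulrCA.
  by apply: eq_bigr => i _; rewrite mulrC.
rewrite -[leRHS]addr0; apply: lerD; last first.
  have [x0|/existsNP[i xi]] := pselect (forall i, x i = 0).
    by rewrite mulr_ge0_le0 ?sumr_le0 ?mulr_ge0 // => i _; exact: w2.
  by rewrite a0E ?mul0r //; exists i; exact/eqP.
apply: sumr_le0 => j /eqP xj; rewrite mulr_ge0_le0 //.
have [bj1|bj1] := eqVneq (b j) 1; last first.
  rewrite dotp_gps_dir // mulr_le0_ge0 ?subr_le0 ?w1 // invr_ge0 subr_ge0.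
  exact: weight_le1.
(* One-point index set: [d_j] is [e_j], and [x j = 0] makes [x] the origin, where the second polar
   condition applies. *)
have kj := weight_eq1 b0 b1 bj1.
rewrite /dotp (bigD1 j) //= big1 => [|k /eqP]; last by rewrite (kj k).
by rewrite /gps_dir eqxx mulr1 addr0; apply: w2 => k; rewrite (kj k).
Qed.
End Polar.

(** * Subgradients of the l1-norm as test vectors *)

Section Separation.
Context {R : realType} {A : finType}.
Variable b : A -> R.
Hypothesis b_gt0 : forall i, 0 < b i.
Hypothesis b_sum1 : \sum_i b i = 1.
Implicit Types x y z : A -> R.

Let both0 x y i := (x i == 0) && (y i == 0).

Let sepc x y := (\sum_(i | ~~ both0 x y i) b i * Num.sg (x i - y i)) /
  (\sum_(i | ~~ both0 x y i) b i).

(* A subgradient of the l1-norm at [x - y]: where this norm is flat because [x i]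
   and [y i] both vanish, the slope is the [b]-average of the others, hence of
   all of them. *)
Definition sep x y i := if both0 x y i then sepc x y else Num.sg (x i - y i).

Lemma sepN x y : sep y x = fun i => - sep x y i.
Proof.
have bC i : both0 y x i = both0 x y i by rewrite /both0 andbC.
apply/funext => i; rewrite /sep bC; case: ifP => _; last by rewrite -sgrN opprB.
rewrite /sepc -mulNr -sumrN; congr (_ / _); last by apply: eq_bigl => j; rewrite bC.
by apply: eq_big => [j|j _]; rewrite ?bC // -mulrN -sgrN opprB.
Qed.

Let sep_den_ge0 x y : 0 <= \sum_(i | ~~ both0 x y i) b i.
Proof. by apply: sumr_ge0 => i _; exact: ltW. Qed.

Let sepc_le1 x y : `|sepc x y| <= 1.
Proof.
rewrite /sepc normrM normfV (ger0_norm (sep_den_ge0 x y)).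
have [->|D0] := eqVneq (\sum_(i | ~~ both0 x y i) b i) 0.
  by rewrite invr0 mulr0.
have D1 : 0 < \sum_(i | ~~ both0 x y i) b i by rewrite lt_def D0 sep_den_ge0.
rewrite ler_pdivrMr // mul1r; apply: le_trans (ler_norm_sum _ _ _) _.
apply: ler_sum => i _; rewrite normrM gtr0_norm // ler_piMr //; first exact: ltW.
by rewrite normr_sg lern1; case: eqP.
Qed.

Lemma sep_le1 x y i : `|sep x y i| <= 1.
Proof.
by rewrite /sep; case: ifP => // _; rewrite normr_sg lern1; case: eqP.
Qed.

Lemma dotp_sep x y : dotp b (sep x y) = sepc x y.
Proof.
rewrite /dotp (bigID (both0 x y)) /=.
rewrite (eq_bigr (fun i => b i * sepc x y)); last by move=> i Bi; rewrite /sep Bi.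
rewrite [X in _ + X](eq_bigr (fun i => b i * Num.sg (x i - y i))); last first.
  by move=> i /negbTE Bi; rewrite /sep Bi.
have := b_sum1; rewrite (bigID (both0 x y)) /= -mulr_suml => /eqP.
rewrite eq_sym -subr_eq => /eqP <-; rewrite mulrBl mul1r.
have [D0|D0] := eqVneq (\sum_(i | ~~ both0 x y i) b i) 0; last first.
  by rewrite [X in _ - X]mulrC {2}/sepc divfK // subrK.
rewrite D0 mul0r subr0 big1 ?addr0 // => i Bi.
suff : 0 < 0 :> R by rewrite ltxx.
rewrite -[X in _ < X]D0 (bigD1 i) //= ltr_pwDl // sumr_ge0 // => j _.
exact: ltW.
Qed.

(** Where [x i = 0 < y i] the slope is -1, which is below every average of signs; where both vanish
    it equals the average; and if [x = 0], no sign is positive. *)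
Lemma polar_sep x y : orthant x -> orthant y -> polar_dir b (sep x y) x.
Proof.
move=> x0 y0; split=> [i xi|xE i].
  rewrite dotp_sep /sep /both0 xi eqxx /=; case: ifPn => // yi.
  rewrite sub0r sgrN gtr0_sg ?lt_def ?yi ?y0 //.
  by have := sepc_le1 x y; rewrite ler_norml => /andP[].
have s0 j : b j * Num.sg (x j - y j) <= 0.
  by rewrite xE sub0r pmulr_rle0 // sgrN oppr_le0 sgr_ge0 y0.
rewrite /sep; case: ifP => _.
  rewrite /sepc mulr_le0_ge0 ?invr_ge0 // sumr_le0 // => j _; exact: s0.
by have := s0 i; rewrite pmulr_rle0.
Qed.

Lemma polar_sepN x y : orthant x -> orthant y ->
  polar_dir b (fun i => - sep x y i) y.
Proof. by move=> x0 y0; rewrite -sepN; exact: polar_sep. Qed.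

Lemma sep_subgradient x y z :
  \sum_i `|x i - y i| + dotp (sep x y) (fun i => z i - (x i - y i)) <=
    \sum_i `|z i|.
Proof.
rewrite /dotp -big_split /=; apply: ler_sum => i _; rewrite mulrBr.
have -> : sep x y i * (x i - y i) = `|x i - y i|.
  rewrite /sep; case: ifP => [/andP[/eqP -> /eqP ->]|_].
    by rewrite subrr mulr0 normr0.
  by rewrite normrEsg.
rewrite addrC subrK; apply: le_trans (ler_norm _) _.
by rewrite normrM ler_piMl // sep_le1.
Qed.
End Separation.

(** * Uniqueness *)

Section OneSided.
Context {R : realType}.
Implicit Types (t : R) (P : set R) (N : R -> R).

Lemma near_leftP t P : (\forall u \near t^'-, P u) <->
  exists2 d, 0 < d & forall u, t - d < u < t -> P u.
Proof.
split=> [[e /= e0 H]|[d d0 H]].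
  exists e => // u /andP[u1 u2]; apply: H => //=.
  by rewrite /ball_ gtr0_norm ?subr_gt0 // ltrBlDr addrC -ltrBlDr.
exists d => //= u /[swap] ut; rewrite /ball_ /= gtr0_norm ?subr_gt0 // => ud.
by apply: H; rewrite ut andbT ltrBlDr addrC -ltrBlDr.
Qed.

Lemma near_rightP t P : (\forall u \near t^'+, P u) <->
  exists2 d, 0 < d & forall u, t < u < t + d -> P u.
Proof.
split=> [[e /= e0 H]|[d d0 H]].
  exists e => // u /andP[u1 u2]; apply: H => //=.
  by rewrite /ball_ ltr0_norm ?subr_lt0 // opprB ltrBlDl.
exists d => //= u /[swap] ut; rewrite /ball_ /= ltr0_norm ?subr_lt0 // opprB => ud.
by apply: H; rewrite ut /= -ltrBlDl.
Qed.

(** The infimum of the times [s <= t] with [N t <= N s] is again such a time by right continuity,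
    and the condition on the left would yield an earlier one unless it is 0. *)
Lemma right_nonincreasing N T : 0 < T ->
  (forall t, 0 <= t < T -> N u @[u --> t^'+] --> N t) ->
  (forall t, 0 < t < T -> \forall s \near t^'-, N t <= N s) ->
  forall t, 0 <= t < T -> N t <= N 0.
Proof.
move=> T0 Nr Nl t /andP[t0 tT].
pose S := [set s | 0 <= s <= t /\ N t <= N s].
have St : S t by split; rewrite ?t0 /=.
have lbS : has_lbound S by exists 0 => s [/andP[]].
have infS : has_inf S by split => //; exists t.
have a0 : 0 <= inf S by apply: lb_le_inf; [exists t|move=> s [/andP[]]].
have at_ : inf S <= t by exact: ge_inf.
have Na : N t <= N (inf S).
  rewrite leNgt; apply/negP => Nat.
  have aT : inf S < T by exact: le_lt_trans tT.
  have := Nr (inf S); rewrite a0 aT => /(_ isT) Nc.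
  have /near_rightP[d d0 H] : \forall u \near (inf S)^'+, N u < N t.
    exact: cvgr_lt Nc _ Nat.
  have [s Ss sd] := inf_adherent d0 infS.
  have := ge_inf lbS Ss; rewrite le_eqVlt => /predU1P[sE|sa].
    by case: Ss => _; rewrite -sE leNgt Nat.
  by have := H s; rewrite sa sd => /(_ isT); rewrite ltNge (proj2 Ss).
move: a0; rewrite le_eqVlt => /predU1P[->//|a0].
have /near_leftP[d d0 H] : \forall s \near (inf S)^'-, N (inf S) <= N s.
  by apply: Nl; rewrite a0 (le_lt_trans at_).
pose s := Num.max 0 (inf S - d / 2).
have sa : s < inf S by rewrite gt_max a0 /= ltrBlDr ltrDl divr_gt0.
have Ss : S s.
  split; first by rewrite le_max lexx /= ltW // (lt_le_trans sa).
  apply: le_trans Na _; apply: H; rewrite sa andbT.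
  rewrite lt_max; apply/orP; right; rewrite ltrD2l ltrN2 gtr_pMr // invf_lt1 //.
  by rewrite ltr1n.
by have := ge_inf lbS Ss; rewrite leNgt sa.
Qed.
End OneSided.

Section Pushes.
Context {R : realType} {A : finType}.
Variable b : A -> R.
Hypothesis b_gt0 : forall i, 0 < b i.
Hypothesis b_sum1 : \sum_i b i = 1.
Implicit Types (f psi phi eta : R -> A -> R).

Lemma cadlag_left f t i : cadlag f -> 0 < t ->
  f u i @[u --> t^'-] --> left_limit f t i.
Proof. by move=> [_ H] t0; exact: H. Qed.

(* The weak form of the (extended) Skorokhod problem on [0, T[: in place of
   convex hulls, or of a density of [eta], it only retains which half-spaces the
   increments and the jumps of [eta] belong to. *)
Definition gps_pushes (T : R) phi eta : Prop :=
  (forall w s t, 0 <= s -> s < t -> t < T ->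
    (forall u, s < u <= t -> polar_dir b w (phi u)) ->
    dotp w (fun i => eta t i - eta s i) <= 0) /\
  (forall w t, 0 < t -> t < T -> polar_dir b w (phi t) ->
    dotp w (fun i => eta t i - left_limit eta t i) <= 0).

Lemma gps_ESP_pushes T psi phi eta :
  gps_ESP b psi phi eta -> gps_pushes T phi eta.
Proof.
move=> [_ _ _ H]; split=> [w s t s0 st _ wu|w t t0 _ wt].
  have [_ _ /(_ s) + _] := H t (ltW (le_lt_trans s0 st)).
  rewrite s0 st => /(_ isT); apply: closed_convex_hull_halfspace.
  by move=> z [u /=]; rewrite in_itv /= => /wu wu' ; exact: gps_cone_polar.
have [_ _ _ /(_ t0)] := H t (ltW t0).
by apply: closed_convex_hull_halfspace => z; exact: gps_cone_polar.
Qed.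

Lemma dotp_cvg (F : set_system R) (w : A -> R) f (l : A -> R) : Filter F ->
  (forall i, f u i @[u --> F] --> l i) -> dotp w (f u) @[u --> F] --> dotp w l.
Proof.
by move=> FF H; apply: cvg_sumr => // i _; apply: cvgM => //; exact: cvg_cst.
Qed.

(** A coordinate with positive left limit is positive shortly before [t], and there are finitely
    many coordinates. So a polar vector at the left limit is polar at all times shortly before
    [t]. *)
Lemma left_zero (phi : R -> A -> R) t : cadlag phi -> 0 < t ->
  (forall u, 0 <= u < t -> orthant (phi u)) ->
  \forall s \near t^'-, forall i, phi s i = 0 -> left_limit phi t i = 0.
Proof.
move=> cphi t0 phi0; apply: filter_forall => i.
have [->|li0] := eqVneq (left_limit phi t i) 0; first exact: nearW.
have l0 : 0 < left_limit phi t i.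
  rewrite lt_def li0 /=.
  apply: (@cvgr_to_ge _ _ _ _ _ _ _ (cadlag_left cphi t0)).
  near=> s; suff : 0 <= s < t by move=> /phi0.
  apply/andP; split.
    by apply: ltW; near: s; exact: nbhs_left_gt.
  by near: s; exact: nbhs_left_lt.
have H : \forall s \near t^'-, 0 < phi s i.
  exact: cvgr_gt (cadlag_left cphi t0) _ l0.
by near=> s => E; have : 0 < phi s i by [near: s]; rewrite E ltxx.
Unshelve. all: by end_near. Qed.

Lemma left_limit_ge0 phi t : cadlag phi -> 0 < t ->
  (forall u, 0 <= u < t -> orthant (phi u)) -> orthant (left_limit phi t).
Proof.
move=> cphi t0 phi0 i.
apply: (@cvgr_to_ge _ _ _ _ _ _ _ (cadlag_left cphi t0)).
near=> s; suff : 0 <= s < t by move=> /phi0.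
  apply/andP; split.
  by apply: ltW; near: s; exact: nbhs_left_gt.
by near: s; exact: nbhs_left_lt.
Unshelve. all: by end_near. Qed.

(** The increment over [[s, t[], without the jump at [t]: one [w] serves all intervals []s, u]] with
    [u < t], and then [u] tends to [t]. *)
Lemma pushes_left T phi eta w t : cadlag phi -> cadlag eta ->
  0 < t < T -> (forall u, 0 <= u < T -> orthant (phi u)) ->
  gps_pushes T phi eta -> polar_dir b w (left_limit phi t) ->
  \forall s \near t^'-, dotp w (fun i => left_limit eta t i - eta s i) <= 0.
Proof.
move=> cphi ceta /andP[t0 tT] phi0 [push _] [w1 w2].
have phi0' u : 0 <= u < t -> orthant (phi u).
  by move=> /andP[u0 ut]; apply: phi0; rewrite u0 (lt_trans ut).
have /near_leftP[d d0 H] := left_zero cphi t0 phi0'.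
near=> s.
have sd : t - d < s by near: s; apply: nbhs_left_gt; rewrite ltrBlDr ltrDl.
have s0 : 0 <= s by apply: ltW; near: s; exact: nbhs_left_gt.
have st : s < t by near: s; exact: nbhs_left_lt.
apply: (@cvgr_to_le _ (t^'-) _ R (fun u => dotp w (fun i => eta u i - eta s i))).
  apply: dotp_cvg => i; apply: cvgB; first exact: cadlag_left.
  exact: cvg_cst.
near=> u.
have su : s < u by near: u; exact: nbhs_left_gt.
have ut : u < t by near: u; exact: nbhs_left_lt.
apply: push => //; first exact: lt_trans tT.
move=> v /andP[sv vu].
have Hv : forall i, phi v i = 0 -> left_limit phi t i = 0.
  by apply: H; rewrite (lt_trans sd sv) (le_lt_trans vu).
split=> [i /Hv|v0 i]; first exact: w1.
by apply: w2 => j; exact/Hv/v0.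
Unshelve. all: by end_near. Qed.

Lemma gps_pushes_unique T (phi1 eta1 phi2 eta2 : R -> A -> R) : 0 < T ->
  cadlag phi1 -> cadlag eta1 -> cadlag phi2 -> cadlag eta2 ->
  (forall t, 0 <= t < T -> orthant (phi1 t)) ->
  (forall t, 0 <= t < T -> orthant (phi2 t)) ->
  (forall t i, 0 <= t < T -> phi1 t i - phi2 t i = eta1 t i - eta2 t i) ->
  (forall i, phi1 0 i = phi2 0 i) ->
  gps_pushes T phi1 eta1 -> gps_pushes T phi2 eta2 ->
  forall t i, 0 <= t < T -> phi1 t i = phi2 t i.
Proof.
move=> T0 cphi1 ceta1 cphi2 ceta2 o1 o2 E E0 p1 p2 t i tT.
suff : \sum_i `|phi1 t i - phi2 t i| <= \sum_i `|phi1 0 i - phi2 0 i|.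
  rewrite [leRHS]big1 => [|j _]; last by rewrite E0 subrr normr0.
  rewrite (bigD1 i) //= => S0; apply/eqP; rewrite -subr_eq0 -normr_le0.
  by apply: le_trans S0; rewrite lerDl sumr_ge0.
apply: (@right_nonincreasing R (fun t => \sum_i `|phi1 t i - phi2 t i|) T) => // {tT}t.
  move=> /andP[t0 tT]; apply: cvg_sumr => j _; apply: cvg_norm; apply: cvgB.
    exact: (proj1 cphi1).
  exact: (proj1 cphi2).
move=> tT; have /andP[t0 tT'] := tT.
set X := left_limit phi1 t; set Y := left_limit phi2 t.
have o1' u : 0 <= u < t -> orthant (phi1 u).
  by move=> /andP[u0 ut]; apply: o1; rewrite u0 (lt_trans ut).
have o2' u : 0 <= u < t -> orthant (phi2 u).
  by move=> /andP[u0 ut]; apply: o2; rewrite u0 (lt_trans ut).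
have X0 : orthant X := left_limit_ge0 cphi1 t0 o1'.
have Y0 : orthant Y := left_limit_ge0 cphi2 t0 o2'.
have XY j : X j - Y j = left_limit eta1 t j - left_limit eta2 t j.
  apply: (@cvg_unique _ (@Rhausdorff R) (phi1 u j - phi2 u j @[u --> t^'-])).
    by apply: cvgB; exact: cadlag_left.
  apply: cvg_trans (_ : eta1 u j - eta2 u j @[u --> t^'-] --> _); last first.
    by apply: cvgB; exact: cadlag_left.
  apply: near_eq_cvg; near=> u; rewrite E //; apply/andP; split.
    by apply: ltW; near: u; exact: nbhs_left_gt.
  by apply: lt_trans tT'; near: u; exact: nbhs_left_lt.
have XYd w : dotp w X - dotp w Y =
    dotp w (left_limit eta1 t) - dotp w (left_limit eta2 t).
  by rewrite -!dotpBr; congr dotp; exact/funext.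
have Ed w u : 0 <= u < T -> dotp w (phi1 u) - dotp w (phi2 u) =
    dotp w (eta1 u) - dotp w (eta2 u).
  by move=> uT; rewrite -!dotpBr; congr dotp; apply/funext => j; exact: E.
have H1 := pushes_left cphi1 ceta1 tT o1 p1 (polar_sep b_gt0 b_sum1 X0 Y0).
have H2 := pushes_left cphi2 ceta2 tT o2 p2 (polar_sepN b_gt0 b_sum1 X0 Y0).
(* The distance of the left limits lies in between. The jump at [t] is tested against the
   subgradient at the values at [t], the increment from [s] to [t-] against the subgradient at the
   left limits. *)
near=> s; apply: (@le_trans _ _ (\sum_i `|X i - Y i|)).
  have t0T : 0 <= t < T by rewrite ltW.
  apply: le_trans (sep_subgradient b_gt0 (phi1 t) (phi2 t) (fun j => X j - Y j)).
  rewrite lerDl.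
  have q1 := (proj2 p1) _ t t0 tT' (polar_sep b_gt0 b_sum1 (o1 t t0T) (o2 t t0T)).
  have q2 := (proj2 p2) _ t t0 tT' (polar_sepN b_gt0 b_sum1 (o1 t t0T) (o2 t t0T)).
  move: q1 q2 (XYd (sep b (phi1 t) (phi2 t))) (Ed (sep b (phi1 t) (phi2 t)) _ t0T).
  rewrite dotpNl !dotpBr -/X -/Y; lra.
have sT : 0 <= s < T.
  apply/andP; split; first by apply: ltW; near: s; exact: nbhs_left_gt.
  by apply: lt_trans tT'; near: s; exact: nbhs_left_lt.
apply: le_trans (sep_subgradient b_gt0 X Y (fun j => phi1 s j - phi2 s j)).
rewrite lerDl.
have q1 : dotp (sep b X Y) (fun i => left_limit eta1 t i - eta1 s i) <= 0.
  by near: s.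
have q2 : dotp (fun i => - sep b X Y i) (fun i => left_limit eta2 t i - eta2 s i) <= 0.
  by near: s.
move: q1 q2 (XYd (sep b X Y)) (Ed (sep b X Y) _ sT).
rewrite dotpNl !dotpBr; lra.
Unshelve. all: by end_near. Qed.
End Pushes.

(** * Reduction to the index set outside of S *)

Section Shift.
Context {R : realType}.
Implicit Types (f : R -> R) (c t l : R).

Lemma cvg_right_shift f c t l :
  f v @[v --> (c + t)^'+] --> l -> f (c + u) @[u --> t^'+] --> l.
Proof.
move=> H P /H /near_rightP[d d0 Hd]; apply/near_rightP; exists d => // u.
by move=> /andP[tu ud]; apply: Hd; rewrite ltrD2l tu -addrA ltrD2l.
Qed.

Lemma cvg_left_shift f c t l :
  f v @[v --> (c + t)^'-] --> l -> f (c + u) @[u --> t^'-] --> l.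
Proof.
move=> H P /H /near_leftP[d d0 Hd]; apply/near_leftP; exists d => // u.
by move=> /andP[tu ud]; apply: Hd; rewrite -addrA !ltrD2l tu.
Qed.

Lemma cadlag_shift {A : finType} (F : R -> A -> R) c : 0 <= c -> cadlag F ->
  cadlag (fun u => F (c + u)).
Proof.
move=> c0 [Fr Fl]; split=> t i t0.
  by apply: (@cvg_right_shift (F^~ i)); apply: Fr; exact: addr_ge0.
apply/cvg_ex; exists (left_limit F (c + t) i).
apply: (@cvg_left_shift (F^~ i)).
by apply: Fl; rewrite ltr_wpDl.
Qed.

Lemma left_limit_shift {A : finType} (F : R -> A -> R) c t i : 0 <= c -> 0 < t ->
  cadlag F -> left_limit (fun u => F (c + u)) t i = left_limit F (c + t) i.
Proof.
move=> c0 t0 [_ Fl]; apply: cvg_lim; first exact: Rhausdorff.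
by apply: (@cvg_left_shift (F^~ i)); apply: Fl; rewrite ltr_wpDl.
Qed.

Lemma cadlagB_cst {A : finType} (F : R -> A -> R) (x : A -> R) : cadlag F ->
  cadlag (fun u i => F u i - x i).
Proof.
move=> [Fr Fl]; split=> t i t0; first by apply: cvgB; [exact: Fr|exact: cvg_cst].
by apply: is_cvgB; [exact: Fl|exact: is_cvg_cst].
Qed.

Lemma left_limitB_cst {A : finType} (F : R -> A -> R) (x : A -> R) t i :
  cadlag F -> 0 < t ->
  left_limit (fun u i => F u i - x i) t i = left_limit F t i - x i.
Proof.
move=> cF t0; apply: cvg_lim; first exact: Rhausdorff.
by apply: cvgB; [exact: cadlag_left|exact: cvg_cst].
Qed.
End Shift.

Section Reduction.
Context {R : realType} {J : nat}.
Variables (beta : 'I_J -> R) (S : {set 'I_J}).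
Hypothesis beta_gt0 : forall i, 0 < beta i.
Hypothesis beta_sum1 : \sum_i beta i = 1.
Hypothesis S_proper : S \proper [set: 'I_J]%SET.
Implicit Types (psi phi eta : R -> 'I_J -> R) (w : rest S -> R).

Lemma sum_rest (F : 'I_J -> R) :
  \sum_(i : rest S) F (val i) = \sum_(i | i \notin S) F i.
Proof. by rewrite -(big_sub [pred i | i \notin S] F). Qed.

Lemma sum_restC (F : 'I_J -> R) :
  \sum_i F i = \sum_(i in S) F i + \sum_(i : rest S) F (val i).
Proof. by rewrite sum_rest (bigID [in S]). Qed.

Lemma weight_rest_gt0 : 0 < \sum_(k in ~: S) beta k.
Proof.
have [_ [k _ kS]] := properP S_proper.
rewrite (bigD1 k) /=; last by rewrite finset.in_setC.
by rewrite ltr_pwDl // sumr_ge0 // => j _; exact: ltW.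
Qed.

Lemma weightK_gt0 i : 0 < weightK S beta i.
Proof. by rewrite divr_gt0 // weight_rest_gt0. Qed.

Lemma weightK_sum1 : \sum_i weightK S beta i = 1.
Proof.
rewrite -mulr_suml (sum_rest beta).
under eq_bigl do rewrite -finset.in_setC.
by rewrite divff // gt_eqF // weight_rest_gt0.
Qed.

(* The extension of [w] that is constant on [S] and has the same weighted
   average: it is the transpose of [pathK S beta] applied to [w]. *)
Definition extK w : 'I_J -> R :=
  fun j => oapp w (dotp (weightK S beta) w) (insub j).

Lemma extK_val w i : extK w (val i) = w i.
Proof. by rewrite /extK valK. Qed.

Lemma extK_in w j : j \in S -> extK w j = dotp (weightK S beta) w.
Proof. by move=> jS; rewrite /extK insubF //= jS. Qed.

Lemma dotp_extK w psi t : dotp w (pathK S beta psi t) = dotp (extK w) (psi t).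
Proof.
rewrite [RHS]/dotp sum_restC addrC.
under [X in _ = X + _]eq_bigr do rewrite extK_val.
under [X in _ = _ + X]eq_bigr => j jS do rewrite extK_in //.
rewrite -mulr_sumr /dotp mulr_suml -big_split; apply: eq_bigr => i _ /=.
by rewrite /pathK; ring.
Qed.

Lemma dotp_weight_extK w : dotp beta (extK w) = dotp (weightK S beta) w.
Proof.
have D0 := weight_rest_gt0; set D := \sum_(k in ~: S) beta k in D0.
rewrite [LHS]/dotp sum_restC.
under [X in X + _]eq_bigr => j jS do rewrite extK_in //.
under [X in _ + X]eq_bigr do rewrite extK_val.
have -> : \sum_(i : rest S) beta (val i) * w i = D * dotp (weightK S beta) w.
  rewrite /dotp mulr_sumr; apply: eq_bigr => i _; rewrite /weightK -/D.
  by field; rewrite gt_eqF.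
rewrite -mulr_suml -mulrDl.
suff -> : \sum_(i in S) beta i + D = 1 by rewrite mul1r.
rewrite -beta_sum1 sum_restC sum_rest; congr (_ + _).
by apply: eq_bigl => k; rewrite finset.in_setC.
Qed.

(** On [S] the extension equals the average, so the first polar condition is an equality there;
    elsewhere it is the one for [w], as both averages agree. *)
Lemma polar_extK w (x : 'I_J -> R) : (forall i, i \in S -> x i = 0) ->
  polar_dir (weightK S beta) w (fun i => x (val i)) -> polar_dir beta (extK w) x.
Proof.
move=> xS [w1 w2]; split=> [j xj|x0 j].
  rewrite dotp_weight_extK; have [jS|jS] := boolP (j \in S); first by rewrite extK_in.
  by rewrite -[j]/(val (Sub j jS : rest S)) extK_val w1.
have w0 := w2 (fun i => x0 (val i)); have [jS|jS] := boolP (j \in S).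
  rewrite extK_in //; apply: sumr_le0 => i _; rewrite mulr_ge0_le0 //.
  exact/ltW/weightK_gt0.
by rewrite -[j]/(val (Sub j jS : rest S)) extK_val w0.
Qed.
Lemma cvg_pathK (F : set_system R) psi (l : R -> 'I_J -> R) t i : Filter F ->
  (forall j, psi u j @[u --> F] --> l t j) ->
  pathK S beta psi u i @[u --> F] --> pathK S beta l t i.
Proof.
move=> FF H; apply: cvgD; first exact: H.
by apply: cvgM; [exact: cvg_cst|apply: cvg_sumr => j _; exact: H].
Qed.

Lemma cadlag_pathK psi : cadlag psi -> cadlag (pathK S beta psi).
Proof.
move=> cpsi; split=> t i t0.
  by apply: cvg_pathK => j; exact: (proj1 cpsi).
apply/cvg_ex; exists (pathK S beta (left_limit psi) t i).
by apply: cvg_pathK => j; exact: cadlag_left.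
Qed.

Lemma left_limit_pathK psi t i : cadlag psi -> 0 < t ->
  left_limit (pathK S beta psi) t i = pathK S beta (left_limit psi) t i.
Proof.
move=> cpsi t0; apply: cvg_lim; first exact: Rhausdorff.
by apply: cvg_pathK => j; exact: cadlag_left.
Qed.

Lemma pathKB psi t s i :
  pathK S beta psi t i - pathK S beta psi s i =
  pathK S beta (fun _ j => psi t j - psi s j) 0 i.
Proof. by rewrite /pathK sumrB; ring. Qed.

Lemma restrictK_pathK phi t i : (forall j, j \in S -> phi t j = 0) ->
  restrictK S phi t i = pathK S beta phi t i.
Proof. by move=> phi0; rewrite /pathK big1 // mulr0 addr0. Qed.

(** By transposition, an increment of [pathK S beta eta] tested against [w] is the increment of
    [eta] tested against [extK w]. *)
Lemma pushes_reduced T0 T phi eta : 0 <= T0 -> cadlag eta ->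
  (forall t, T0 <= t < T -> forall i, i \in S -> phi t i = 0) ->
  gps_pushes beta T phi eta ->
  gps_pushes (weightK S beta) (T - T0) (fun u => restrictK S phi (T0 + u))
    (fun u i => pathK S beta eta (T0 + u) i - pathK S beta eta T0 i).
Proof.
move=> T00 ceta phiS [p1 p2].
have polar w u : 0 <= u -> u < T - T0 ->
    polar_dir (weightK S beta) w (restrictK S phi (T0 + u)) ->
    polar_dir beta (extK w) (phi (T0 + u)).
  move=> u0 uT; apply: polar_extK; apply: phiS.
  by rewrite lerDl u0 -ltrBrDl.
split=> [w s t s0 st tT wu|w t t0 tT wt].
  have := p1 (extK w) (T0 + s) (T0 + t).
  rewrite addr_ge0 // ltrD2l st -ltrBrDl tT => /(_ isT isT isT) H.
  rewrite (_ : (fun i => _) = pathK S beta (fun _ j => eta (T0 + t) j - eta (T0 + s) j) 0).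
    rewrite dotp_extK; apply: H => u /andP[su ut].
    rewrite -(subrK T0 u) addrC; apply: polar.
    - by rewrite subr_ge0 (le_trans _ (ltW su)) // lerDl.
    - by rewrite ltrD2r; apply: le_lt_trans ut _; rewrite -ltrBrDl.
    - by apply: wu; rewrite ltrBrDl su lerBlDl.
  by apply/funext => i; rewrite opprB addrA subrK pathKB.
have := p2 (extK w) (T0 + t); rewrite ltr_wpDl // -ltrBrDl tT => /(_ isT isT) H.
rewrite (_ : (fun i => _) =
    pathK S beta (fun _ j => eta (T0 + t) j - left_limit eta (T0 + t) j) 0).
  by rewrite dotp_extK; apply: H; apply: polar => //; exact: ltW.
apply/funext => i; rewrite left_limitB_cst //; last first.
  by apply: cadlag_shift => //; exact: cadlag_pathK.
rewrite left_limit_shift //; last exact: cadlag_pathK.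
rewrite left_limit_pathK //; last by rewrite ltr_wpDl.
by rewrite opprB addrA subrK /pathK sumrB; ring.
Qed.

Lemma reduced_unique psi phi eta T0 T (phi' eta' : R -> rest S -> R) :
  0 <= T0 -> cadlag phi -> cadlag eta ->
  (forall t i, 0 <= t -> phi t i = psi t i + eta t i) ->
  (forall t, 0 <= t -> orthant (phi t)) ->
  (forall t, T0 <= t < T -> forall i, i \in S -> phi t i = 0) ->
  gps_pushes beta T phi eta ->
  cadlag phi' -> cadlag eta' ->
  (forall t i, 0 <= t ->
    phi' t i = restart T0 (restrictK S phi T0) (pathK S beta psi) t i + eta' t i) ->
  (forall t, 0 <= t -> orthant (phi' t)) ->
  (forall i, phi' 0 i = restrictK S phi T0 i) ->
  gps_pushes (weightK S beta) (T - T0) phi' eta' ->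
  forall t i, T0 <= t < T -> restrictK S phi t i = phi' (t - T0) i.
Proof.
move=> T00 cphi ceta phiE phi0 phiS push cphi' ceta' phi'E phi'0 phi'I push' t i.
move=> /andP[T0t tT]; have T0T : T0 < T by exact: le_lt_trans tT.
rewrite -[t in LHS](subrKC T0).
apply: (gps_pushes_unique weightK_gt0 weightK_sum1 _
  (cadlag_shift T00 _) (cadlagB_cst _ (cadlag_shift T00 (cadlag_pathK ceta)))
  cphi' ceta' _ _ _ _ (pushes_reduced T00 ceta phiS push) push').
- by rewrite subr_gt0.
- by split=> s j s0; [exact: (proj1 cphi)|exact: (proj2 cphi)].
- by move=> s /andP[s0 _] j; apply: phi0; exact: addr_ge0.
- by move=> s /andP[s0 _]; exact: phi'0.
(* At [T0] and at [T0 + s] the path vanishes on [S], so its restriction is its image under the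
   linear map [pathK]. *)
- move=> s j /andP[s0 sT]; rewrite phi'E // /restart.
  rewrite !(@restrictK_pathK phi); last 2 first.
  + by apply: phiS; rewrite lexx.
  + by apply: phiS; rewrite lerDl s0 -ltrBrDl.
  have Sphi u : 0 <= u ->
      \sum_(k in S) phi u k = \sum_(k in S) psi u k + \sum_(k in S) eta u k.
    by move=> u0; rewrite -big_split; apply: eq_bigr => k _; rewrite phiE.
  by rewrite /pathK !phiE ?addr_ge0 // !Sphi ?addr_ge0 //; ring.
- by move=> j; rewrite addr0 phi'I.
- by rewrite subr_ge0 T0t ltrD2r.
Qed.
End Reduction.

(** * The fixed point equation *)

Section FixedPoint.
Context {R : realType} {A : finType}.
Variables (b : A -> R) (psi m : R -> A -> R) (M L : R -> R).
Hypothesis b_gt0 : forall i, 0 < b i.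
Hypothesis psi_rc : forall t i, 0 <= t -> psi u i @[u --> t^'+] --> psi t i.
Hypothesis m_nd : forall s t i, 0 <= s -> s <= t -> m s i <= m t i.
Hypothesis m_0 : forall i, m 0 i = 0.
Hypothesis M_rc : forall t, 0 <= t -> M u @[u --> t^'+] --> M t.
Hypothesis L_rc : forall t, 0 <= t -> L u @[u --> t^'+] --> L t.
Hypothesis LE : forall t, 0 <= t -> L t = \sum_i m t i - M t.
Hypothesis mM_ge0 : forall t i, 0 <= t -> 0 <= psi t i - b i * M t + m t i.
Implicit Types (Y : R -> R) (s t u : R) (i : A).

(** The element 0 takes the positive part, and keeps the set nonempty at negative times, where the
    supremum is then 0. *)
Definition regset Y t i : set R :=
  [set x | x = 0 \/ exists2 s, 0 <= s <= t & x = b i * Y s - psi s i].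

(* The regulator of the one-dimensional reflection at [0] of [psi_i - b_i Y]. *)
Definition reg Y t i : R := sup (regset Y t i).

Let below Y := forall t, 0 <= t -> Y t <= M t.

Lemma reg_le Y t i (x : R) : 0 <= x ->
  (forall s, 0 <= s <= t -> b i * Y s - psi s i <= x) -> reg Y t i <= x.
Proof.
move=> x0 H; apply: ge_sup; first by exists 0; left.
by move=> _ [->|[s st ->]] //; exact: H.
Qed.

Lemma m_ge0 t i : 0 <= t -> 0 <= m t i.
Proof. by move=> t0; rewrite -(m_0 i) m_nd. Qed.

Let has_sup_regset Y t i : below Y -> has_sup (regset Y t i).
Proof.
move=> YM; split; first by exists 0; left.
exists (m (Num.max 0 t) i) => _ [->|[s /andP[s0 st] ->]].
  by rewrite m_ge0 // le_max lexx.
apply: le_trans (_ : m s i <= _); last by rewrite m_nd // le_max st orbT.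
have := mM_ge0 i s0; have := YM s s0; rewrite -(ler_pM2l (b_gt0 i)); lra.
Qed.

Lemma reg_ge0 Y t i : below Y -> 0 <= reg Y t i.
Proof.
by move=> YM; apply: ub_le_sup; [have [] := has_sup_regset t i YM|left].
Qed.

Lemma reg_ge Y t i s : below Y -> 0 <= s <= t -> b i * Y s - psi s i <= reg Y t i.
Proof.
move=> YM st; apply: ub_le_sup; first by have [] := has_sup_regset t i YM.
by right; exists s.
Qed.

(** [m] is nonnegative, nondecreasing and keeps [psi_i - b_i M] above 0, and the running supremum
    for [M] is the least such function. With [LE] this makes [M] a supersolution. *)
Lemma reg_le_m Y t i : below Y -> 0 <= t -> reg Y t i <= m t i.
Proof.
move=> YM t0; apply: reg_le; first exact: m_ge0.
move=> s /andP[s0 st]; apply: le_trans (m_nd i s0 st).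
have := mM_ge0 i s0; have := YM s s0; rewrite -(ler_pM2l (b_gt0 i)); lra.
Qed.

Lemma reg_nd Y s t i : below Y -> s <= t -> reg Y s i <= reg Y t i.
Proof.
move=> YM st; apply: reg_le; first exact: reg_ge0.
move=> u /andP[u0 us]; apply: reg_ge => //.
by rewrite u0 (le_trans us).
Qed.

Lemma reg_mono Y Y' t i : below Y' -> (forall s, 0 <= s <= t -> Y s <= Y' s) ->
  reg Y t i <= reg Y' t i.
Proof.
move=> YM YY'; apply: reg_le; first exact: reg_ge0.
move=> s st; apply: le_trans (reg_ge i YM st).
by rewrite lerD2r ler_pM2l // YY'.
Qed.

Let F Y t := \sum_i reg Y t i - L t.

Let subfixed Y :=
  forall t, 0 <= t -> [/\ - L t <= Y t, Y t <= M t & Y t <= F Y t].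

(* Knaster-Tarski: the greatest fixed point of [F] between [- L] and [M]. *)
Definition gfix t := sup [set x | exists2 Y, subfixed Y & x = Y t].

Let L_sub : subfixed (fun t => - L t).
Proof.
have LM : below (fun t => - L t).
  by move=> t t0; rewrite LE // opprB gerBl sumr_ge0 // => i _; exact: m_ge0.
move=> t t0; split => //; first exact: LM.
by rewrite lerDr sumr_ge0 // => i _; exact: reg_ge0.
Qed.

Let gfix_has_sup t : 0 <= t -> has_sup [set x | exists2 Y, subfixed Y & x = Y t].
Proof.
move=> t0; split; first by exists (- L t); exists (fun t => - L t).
by exists (M t) => _ [Y /(_ t t0)[_ YM _] ->].
Qed.

Lemma gfix_ge Y t : subfixed Y -> 0 <= t -> Y t <= gfix t.
Proof.
move=> YS t0; apply: ub_le_sup; first by have [] := gfix_has_sup t0.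
by exists Y.
Qed.

Lemma gfix_le t : 0 <= t -> gfix t <= M t.
Proof.
move=> t0; apply: ge_sup; first by have [] := gfix_has_sup t0.
by move=> _ [Y /(_ t t0)[_ YM _] ->].
Qed.

Let gfix_below : below gfix := fun t => @gfix_le t.

Let gfix_sub : subfixed gfix.
Proof.
move=> t t0; split; first exact: (gfix_ge L_sub).
  exact: gfix_below.
apply: ge_sup; first by have [] := gfix_has_sup t0.
move=> _ [Y YS ->]; have [_ _ YF] := YS t t0; apply: le_trans YF _.
rewrite lerD2r; apply: ler_sum => i _; apply: reg_mono => // s /andP[s0 _].
exact: gfix_ge.
Qed.

Lemma gfixE t : 0 <= t -> gfix t = \sum_i reg gfix t i - L t.
Proof.
move=> t0; apply/eqP; rewrite eq_le; apply/andP; split; first by have [] := gfix_sub t0.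
suff FS : subfixed (F gfix) by exact: (gfix_ge FS).
have FM : below (F gfix).
  move=> u u0; rewrite /F (LE u0) opprB addrCA gerDl subr_le0.
  by apply: ler_sum => i _; exact: reg_le_m.
move=> u u0; split; last 1 first.
- rewrite lerD2r; apply: ler_sum => i _; apply: reg_mono => // s /andP[s0 _].
  by have [] := gfix_sub s0.
- by rewrite lerDr sumr_ge0 // => i _; exact: reg_ge0.
- exact: FM.
Qed.

Let rho := reg gfix.

Let rho_right t i : exists q, rho u i @[u --> t^'+] --> q /\ rho t i <= q.
Proof.
have ndr u v : u <= v -> rho u i <= rho v i by move=> uv; exact: reg_nd.
have : cvg (rho u i @[u --> t^'+]).
  apply: (@nondecreasing_at_right_is_cvgr _ (rho^~ i)).
    by near=> v => x y _ _; exact: ndr.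
  near=> v; exists (rho t i) => _ [x /= + <-]; rewrite in_itv /= => /andP[tx _].
  exact/ndr/ltW.
move=> C; exists (lim (rho u i @[u --> t^'+])); split=> //.
apply: limr_ge => //; near=> u; apply: ndr; apply: ltW.
by near: u; exact: nbhs_right_gt.
Unshelve. all: by end_near. Qed.

Let gfix_right_sup t (q : A -> R) : 0 <= t ->
  (forall i, rho u i @[u --> t^'+] --> q i) ->
  gfix u @[u --> t^'+] --> \sum_i q i - L t.
Proof.
move=> t0 qE; apply: cvg_trans (_ : F gfix u @[u --> t^'+] --> _); last first.
  by apply: cvgB; [apply: cvg_sumr => i _; exact: qE|exact: L_rc].
apply: near_eq_cvg; near=> u; rewrite /F -gfixE //.
by apply: le_trans t0 _; apply: ltW; near: u; exact: nbhs_right_gt.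
Unshelve. all: by end_near. Qed.

(* If the right limit of the greatest fixed point exceeded its value at [t],
   raising this value alone would give a larger [subfixed] function. *)
Lemma gfix_rc t : 0 <= t -> gfix u @[u --> t^'+] --> gfix t.
Proof.
move=> t0; have [q qE] := choice (rho_right t).
have Xy := gfix_right_sup t0 (fun i => (qE i).1).
set y := \sum_i q i - L t in Xy.
have Xley : gfix t <= y.
  by rewrite gfixE // lerD2r; apply: ler_sum => i _; exact: (qE i).2.
suff yX : y <= gfix t by rewrite -[X in _ --> X](_ : y = _) //; apply/eqP; rewrite eq_le yX.
pose Y s := if s == t then y else gfix s.
have XY s : gfix s <= Y s by rewrite /Y; case: eqP => [->|].
have yM : y <= M t.
  apply: (@cvgr_to_le _ (t^'+) _ R (fun u => gfix u - M u + M t)).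
    rewrite -[X in _ --> X](addrK (M t)) addrAC; apply: cvgD; last exact: cvg_cst.
    by apply: cvgB; [|exact: M_rc].
  near=> u; rewrite gerDr subr_le0; apply: gfix_below.
  by apply: le_trans t0 _; apply: ltW; near: u; exact: nbhs_right_gt.
have YM : below Y by rewrite /Y => s s0; case: eqP => [->|_] //; exact: gfix_below.
suff YS : subfixed Y by have := gfix_ge YS t0; rewrite /Y eqxx.
move=> s s0; split; last 1 first.
- have [E|ne] := eqVneq s t; last first.
    rewrite {1}/Y (negbTE ne); have [_ _ H] := gfix_sub s0; apply: le_trans H _.
    by rewrite lerD2r; apply: ler_sum => i _; exact: reg_mono.
  rewrite E {1}/Y eqxx lerD2r; apply: ler_sum => i _.
  (* Shortly after [t] the running supremum can exceed its value at [t] only through values near the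
     right limit [b i * y - psi t i], which is exactly what [Y] contributes at [t]. *)
  apply/ler_addgt0Pr => e e0.
  have cy : b i * gfix u - psi u i @[u --> t^'+] --> b i * y - psi t i.
    by apply: cvgB; [apply: cvgM => //; exact: cvg_cst|exact: psi_rc].
  have /near_rightP[d d0 H] : \forall u \near t^'+,
      b i * gfix u - psi u i < b i * y - psi t i + e.
    by apply: cvgr_lt cy _ _; rewrite ltrDl.
  apply: (@cvgr_to_le _ (t^'+) _ R (rho^~ i)); first exact: (qE i).1.
  near=> u; apply: reg_le => [|v /andP[v0 vu]].
    by rewrite addr_ge0 ?reg_ge0 // ltW.
  have [vt|tv] := leP v t.
    apply: le_trans (_ : reg Y t i <= _); last by rewrite lerDl ltW.
    have vt' : 0 <= v <= t by rewrite v0 vt.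
    apply: le_trans (reg_ge i YM vt').
    by rewrite lerD2r ler_pM2l.
  apply: le_trans (ltW (H v _)) _.
    rewrite tv (le_lt_trans vu) //; near: u; apply: nbhs_right_lt.
    by rewrite ltrDl.
  have tt' : 0 <= t <= t by rewrite t0 lexx.
  by rewrite lerD2r; have := reg_ge i YM tt'; rewrite {1}/Y eqxx.
- by apply: le_trans (XY s); have [] := gfix_sub s0.
- exact: YM.
Unshelve. all: by end_near. Qed.

(** The right-hand gaps of the regulators are nonnegative and sum to the gap of the fixed point,
    which is 0. *)
Lemma reg_gfix_rc t i : 0 <= t -> rho u i @[u --> t^'+] --> rho t i.
Proof.
move=> t0; have [q qE] := choice (rho_right t).
have Xy := gfix_right_sup t0 (fun i => (qE i).1).
have E : \sum_i q i - L t = gfix t.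
  exact: (cvg_unique (@Rhausdorff R) Xy (gfix_rc t0)).
suff <- : q i = rho t i by exact: (qE i).1.
apply/eqP; rewrite -subr_eq0.
have : \sum_i (q i - rho t i) == 0.
  by rewrite sumrB subr_eq0 -(inj_eq (addIr (- L t))) E gfixE.
rewrite psumr_eq0; last by move=> j _; rewrite subr_ge0 (qE j).2.
by move=> /allP /(_ i); rewrite mem_index_enum => /(_ isT).
Qed.

Let phi t i := psi t i - b i * gfix t + rho t i.

Lemma gfix_path_ge0 t i : 0 <= t -> 0 <= phi t i.
Proof.
move=> t0; rewrite /phi -opprB addrC subr_ge0; apply: reg_ge => //.
by rewrite t0 lexx.
Qed.

Let c_lt t i : 0 < phi t i -> b i * gfix t - psi t i < rho t i.
Proof. by rewrite /phi; lra. Qed.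

(** At the infimum of the times where the regulator has grown, [b_i gfix - psi_i] lies strictly
    below the running supremum. By right continuity it stays below shortly afterwards, so no growth
    can set in. *)
Lemma reg_flat s t i : 0 <= s -> s <= t ->
  (forall u, s <= u <= t -> 0 < phi u i) -> rho t i = rho s i.
Proof.
move=> s0 st pos; apply/eqP; rewrite eq_le; apply/andP; split; last exact: reg_nd.
rewrite leNgt; apply/negP => lt_st.
pose S := [set u | s <= u <= t /\ rho s i < rho u i].
have St : S t by split; rewrite ?st /=.
have lbS : has_lbound S by exists s => u [/andP[]].
have infS : has_inf S by split => //; exists t.
have s_inf : s <= inf S by apply: lb_le_inf; [exists t|move=> u [/andP[]]].
have inf_t : inf S <= t by exact: ge_inf.
have inf0 : 0 <= inf S by exact: le_trans s_inf.
have rho_lt u : s <= u -> u < inf S -> rho u i <= rho s i.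
  move=> su ui; rewrite leNgt; apply/negP => H.
  have : S u by split=> //; rewrite su ltW // (lt_le_trans ui).
  by move=> /(ge_inf lbS); rewrite leNgt ui.
have pinf : b i * gfix (inf S) - psi (inf S) i < rho (inf S) i.
  by apply/c_lt/pos; rewrite s_inf.
have rho_inf : rho (inf S) i <= rho s i.
  rewrite leNgt; apply/negP => H.
  suff : rho (inf S) i <=
      Num.max (rho s i) (b i * gfix (inf S) - psi (inf S) i).
    by rewrite le_max leNgt H leNgt pinf.
  apply: reg_le => [|u /andP[u0]].
    by rewrite le_max reg_ge0.
  rewrite le_eqVlt => /predU1P[->|ui]; first by rewrite le_max lexx orbT.
  rewrite le_max; apply/orP; left; have [us|su] := leP u s.
    by apply: reg_ge => //; rewrite u0.
  apply: le_trans (rho_lt _ (ltW su) ui).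
  by apply: reg_ge => //; rewrite u0 lexx.
have cc : b i * gfix u - psi u i @[u --> (inf S)^'+] -->
    b i * gfix (inf S) - psi (inf S) i.
  by apply: cvgB; [apply: cvgM; [exact: cvg_cst|exact: gfix_rc]|exact: psi_rc].
have /near_rightP[d d0 H] : \forall u \near (inf S)^'+,
    b i * gfix u - psi u i < rho (inf S) i by exact: cvgr_lt cc _ pinf.
have [u [_ rsu] ud] := inf_adherent d0 infS.
suff : rho u i <= rho (inf S) i by move=> /le_trans /(_ rho_inf); rewrite leNgt rsu.
apply: reg_le => [|v /andP[v0 vu]]; first exact: reg_ge0.
have [vi|iv] := leP v (inf S); first by apply: reg_ge => //; rewrite v0.
by apply/ltW/H; rewrite iv (le_lt_trans vu).
Qed.

(** If [phi t i > 0], the value at [t] itself stays below the supremum, which is therefore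
    approached at earlier times: the regulator does not jump at [t]. *)
Lemma reg_left t i e : 0 < t -> 0 < phi t i -> 0 < e ->
  exists2 s, 0 <= s < t & rho t i - e < rho s i.
Proof.
move=> t0 /c_lt pt e0.
have : Num.max (b i * gfix t - psi t i) (rho t i - e) < rho t i.
  by rewrite gt_max pt gtrBl.
move=> /(sup_gt (proj1 (has_sup_regset t i gfix_below)))[x [->|]].
  rewrite gt_max => /andP[_ H]; exists 0; rewrite ?lexx //.
  by apply: lt_le_trans H _; exact: reg_ge0.
move=> [s /andP[s0 st] ->]; rewrite gt_max => /andP[cs H].
have {st} : s < t.
  by move: st; rewrite le_eqVlt => /predU1P[E|//]; rewrite E ltxx in cs.
move=> st; exists s; first by rewrite s0.
by apply: lt_le_trans H _; apply: reg_ge => //; rewrite s0 lexx.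
Qed.

Lemma reg_neg t i : t <= 0 -> rho t i = 0.
Proof.
move=> t0; apply/eqP; rewrite eq_le reg_ge0 // andbT.
apply: le_trans (reg_nd i gfix_below t0) _.
by have := reg_le_m i gfix_below (lexx 0); rewrite m_0.
Qed.
End FixedPoint.

(** * Densities and Lebesgue-Stieltjes measures *)

Section Density.
Local Open Scope ereal_scope.
Context d (T : measurableType d) (R : realType).
Variable mu : {sigma_finite_measure set T -> \bar R}.

(** On the part of [g < f] inside a set of finite measure, [g] is integrable and the integrals agree
    on all subsets, so [f = g] almost everywhere there. *)
Lemma ae_le_of_integral (D : set T) (f g : T -> \bar R) (c : R) :
  measurable D -> measurable_fun [set: T] f -> measurable_fun [set: T] g ->
  (0 <= c)%R ->
  (forall x, 0 <= f x) -> (forall x, 0 <= g x <= c%:E) ->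
  (forall A, measurable A -> A `<=` D ->
    \int[mu]_(x in A) f x <= \int[mu]_(x in A) g x) ->
  {ae mu, forall x, D x -> f x <= g x}.
Proof.
move=> mD mf mg c0 f0 g0 fg.
have [F TF /all_and2[mF muF]] := sigma_finiteT mu.
pose N k := D `&` F k `&` [set x | g x < f x].
have mN k : measurable (N k).
  by apply: measurable_lte; [exact: measurableI|exact: measurable_funTS..].
have muN k : mu (N k) < +oo.
  by apply: le_lt_trans (muF k); apply: le_measure; rewrite ?inE // => x [[]].
have ig k : mu.-integrable (N k) g.
  apply/integrableP; split; first exact: measurable_funTS.
  apply: (@le_lt_trans _ _ (\int[mu]_(x in N k) c%:E)).
    apply: ge0_le_integral => //.
    - by apply: measurableT_comp => //; exact: measurable_funTS.
    - by move=> x _; have /andP[gx0 gc] := g0 x; rewrite gee0_abs.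
  rewrite integral_cst //; have c0' : 0 <= c%:E by rewrite lee_fin.
  by apply: lte_mul_pinfty => //; exact: muN.
have E k : {ae mu, forall x, N k x -> g x = f x}.
  apply: (integral_ae_eq (mN k) (ig k)); first exact: measurable_funTS.
  move=> A AN mA; apply/eqP; rewrite eq_le; apply/andP; split; last first.
    by apply: fg => // x /AN[[]].
  apply: ge0_le_integral => //; try exact: measurable_funTS.
  - by move=> x _; have /andP[] := g0 x.
  - by move=> x /AN[_ /ltW].
have := ae_foralln E; apply: filterS => x H Dx; rewrite leNgt; apply/negP => gf.
have [k _ Fkx] : (\bigcup_k F k) x by rewrite -TF.
by have := H k (conj (conj Dx Fkx) gf) => gE; rewrite gE ltxx in gf.
Qed.

(** Radon-Nikodym is applied to the finite restrictions of [nu] to disjoint pieces. The glued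
    density is at most [c] almost everywhere, and truncation makes the bound hold everywhere. *)
Lemma bounded_density (nu : {measure set T -> \bar R}) (c : R) : (0 <= c)%R ->
  (forall A, measurable A -> nu A <= c%:E * mu A) ->
  exists h : T -> R, [/\ measurable_fun [set: T] h, forall x, (0 <= h x <= c)%R &
    forall A, measurable A -> nu A = \int[mu]_(x in A) (h x)%:E].
Proof.
move=> c0 numu.
have [F TF /all_and2[mF muF]] := sigma_finiteT mu.
pose D := seqDU F.
have mD k : measurable (D k) by exact: seqDU_measurable.
have nuD k : nu (D k) < +oo.
  apply: le_lt_trans (numu _ (mD k)) _; rewrite lte_mul_pinfty ?lee_fin //.
  apply: le_lt_trans (muF k); apply: le_measure; rewrite ?inE //.
  exact: subset_seqDU.
pose nu_ k : {finite_measure set T -> \bar R} := mfrestr (mD k) (nuD k).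
have nu_mu k : nu_ k `<< mu.
  apply/null_content_dominatesP => A mA muA0; apply/eqP.
  rewrite -measure_le0; apply: le_trans (numu _ (measurableI _ _ mA (mD k))) _.
  rewrite mule_ge0_le0 ?lee_fin // -muA0; apply: le_measure; rewrite ?inE //.
  exact: measurableI.
pose f k := Radon_Nikodym_SigmaFinite.f (nu_ k) mu.
have f0 k x : 0 <= f k x by exact: Radon_Nikodym_SigmaFinite.f_ge0.
have mf k : measurable_fun setT (f k).
  exact: measurable_int (Radon_Nikodym_SigmaFinite.f_integrable (nu_mu k)).
pose fD k := f k \_ (D k).
have fD0 k x : 0 <= fD k x by rewrite /fD patchE; case: ifP.
have mfD k : measurable_fun setT (fD k).
  by apply/measurable_restrict => //; rewrite setTI; exact: measurable_funTS.
pose g x := \sum_(k <oo) fD k x.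
have g0 x : 0 <= g x by apply: nneseries_ge0 => k _ _; exact: fD0.
have mg : measurable_fun setT g by exact: ge0_emeasurable_sum.
have nuE A : measurable A -> nu A = \int[mu]_(x in A) g x.
  move=> mA; rewrite integral_nneseries //; last by move=> k; exact: measurable_funTS.
  rewrite -[A in LHS]setIT TF seqDU_bigcup_eq setI_bigcupr measure_bigcup //; last 2 first.
  - by move=> k _; exact: measurableI.
  - exact/trivIset_setIl/trivIset_seqDU.
  rewrite (@eq_eseriesl _ _ predT) /=; last by move=> k; rewrite in_setT.
  apply: eq_eseriesr => k _; rewrite /fD -integral_mkcondr.
  rewrite -(Radon_Nikodym_SigmaFinite.f_integral (nu_mu k)); last exact: measurableI.
  by rewrite /nu_ /= /mfrestr /mrestr -setIA setIid.
have gc : {ae mu, forall x, [set: T] x -> g x <= c%:E}.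
  apply: (@ae_le_of_integral _ _ (cst c%:E) c) => //.
  - by move=> x; rewrite lee_fin c0 lexx.
  - by move=> A mA _; rewrite -nuE // integral_cst // numu.
pose h x := fine (mine (g x) c%:E).
have hfin x : mine (g x) c%:E \is a fin_num.
  rewrite fin_numElt; apply/andP; split.
    by apply: lt_le_trans (_ : 0 <= _); rewrite ?ltNy0 // le_min g0 lee_fin.
  by rewrite gt_min [X in _ || X]ltry orbT.
exists h; split.
- apply: measurableT_comp => //; exact: measurable_mine.
- move=> x; rewrite -!lee_fin /h fineK // le_min g0 lee_fin c0 /=.
  by rewrite ge_min lexx orbT.
- move=> A mA; rewrite nuE //; apply: ae_eq_integral => //.
  + exact: measurable_funTS.
  + apply: measurable_funTS; apply/measurable_EFinP.
    by apply: measurableT_comp => //; exact: measurable_mine.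
  + apply: filterS gc => x /(_ I) gxc _; rewrite /h fineK //.
    by apply/esym/min_idPl.
Qed.
End Density.

Section Cumulative.
Context {R : realType}.
Implicit Types f g : cumulative R R.

Definition cumul_of (f : R -> R) (nd : nondecreasing f) (rc : right_continuous f) :
  cumulative R R := HB.pack f (isCumulative.Build R _ R f nd rc).

Lemma cumulD_nd f g : nondecreasing (fun x => f x + g x).
Proof. by move=> x y xy; apply: lerD; exact: cumulative_is_nondecreasing. Qed.

Lemma cumulD_rc f g : right_continuous (fun x => f x + g x).
Proof. by move=> x; apply: cvgD; exact: cumulative_is_right_continuous. Qed.

Definition cumulD f g := cumul_of (@cumulD_nd f g) (@cumulD_rc f g).

Lemma cumulZ_nd (c : {nonneg R}) f : nondecreasing (fun x => c%:num * f x).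
Proof. by move=> x y xy; rewrite ler_wpM2l //; exact: cumulative_is_nondecreasing. Qed.

Lemma cumulZ_rc (c : {nonneg R}) f : right_continuous (fun x => c%:num * f x).
Proof.
by move=> x; apply: cvgM; [exact: cvg_cst|exact: cumulative_is_right_continuous].
Qed.

Definition cumulZ c f := cumul_of (@cumulZ_nd c f) (@cumulZ_rc c f).

Local Notation LS := lebesgue_stieltjes_measure.

Lemma LS_oc f (a b : R) : a <= b -> LS f `]a, b] = (f b - f a)%:E.
Proof.
move=> ab; rewrite /LS /measure_extension /=.
by rewrite measurable_mu_extE /= ?wlength_itv_bnd // ; exact: is_ocitv.
Qed.

Lemma LS_unique f (mu : {measure set (measurableTypeR R) -> \bar R}) :
  (forall a b : R, a <= b -> mu `]a, b]%classic = (f b - f a)%:E) ->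
  forall A, measurable A -> LS f A = mu A.
Proof.
move=> H; apply: lebesgue_stieltjes_measure_unique => I [[a b]] /= _ <-.
have [ab|/ltW ba] := leP a b; first by rewrite LS_oc // H.
by rewrite set_itv_ge ?measure0 // bnd_simp -leNgt.
Qed.

(** An identity between differences of cumulative functions, kept as one between sums because the
    measures may be infinite. *)
Lemma LS_add4 (f1 f2 g1 g2 : cumulative R R) :
  (forall a b, a <= b -> f1 b - f1 a + (f2 b - f2 a) = g1 b - g1 a + (g2 b - g2 a)) ->
  forall A, measurable A -> (LS f1 A + LS f2 A = LS g1 A + LS g2 A)%E.
Proof.
move=> H A mA.
have D f g : LS (cumulD f g) A = (LS f A + LS g A)%E.
  rewrite (LS_unique (mu := measure_add (LS f) (LS g))) //; first exact: measure_addE.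
  move=> a b ab; transitivity (LS f `]a, b] + LS g `]a, b])%E; first exact: measure_addE.
  by rewrite !LS_oc // -EFinD /=; congr EFin; lra.
rewrite -!D; apply: LS_unique => // a b ab.
transitivity ((cumulD g1 g2 b - cumulD g1 g2 a)%:E); first exact: LS_oc.
by congr EFin; have := H a b ab; rewrite /=; lra.
Qed.

Section LSdensity.
Variable V : cumulative R R.
Notation mu := (LS V).

Lemma LS_density (K : cumulative R R) (h : R -> R) :
  measurable_fun [set: measurableTypeR R] h -> (forall x, 0 <= h x) ->
  (forall s t, s <= t -> (K t - K s)%:E = (\int[mu]_(x in `]s, t]) (h x)%:E)%E) ->
  forall A, measurable A -> LS K A = (\int[mu]_(x in A) (h x)%:E)%E.
Proof.
move=> mh h0 KE A mA.
pose nu (B : set (measurableTypeR R)) := (\int[mu]_(x in B) (h x)%:E)%E.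
have nu0 : nu set0 = 0%E by rewrite /nu integral_set0.
have nuge0 B : (0 <= nu B)%E by apply: integral_ge0 => x _; rewrite lee_fin.
have nus : semi_sigma_additive nu.
  apply: semi_sigma_additive_nng_induced; first exact/measurable_EFinP.
  by move=> x; rewrite lee_fin.
pose m : {measure set (measurableTypeR R) -> \bar R} :=
  HB.pack nu (isMeasure.Build _ _ _ nu nu0 nuge0 nus).
by rewrite (@LS_unique K m) // => a b ab; rewrite /m /= /nu KE.
Qed.

Lemma bounded_integrable_oc (g : R -> R) (C s t : R) :
  measurable_fun [set: measurableTypeR R] g -> (forall x, `|g x| <= C) ->
  mu.-integrable (`]s, t] : set (measurableTypeR R)) (EFin \o g).
Proof.
move=> mg gC; apply: measurable_bounded_integrable => //.
- have [st|/ltW ts] := leP s t; first by rewrite /= LS_oc // ltry.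
  by rewrite set_itv_ge ?measure0 ?ltry // bnd_simp -leNgt.
- exact: measurable_funTS.
- exists C; split; first exact: num_real.
  by move=> M CM x _ /=; apply: le_trans (gC x) (ltW CM).
Qed.

Lemma integral_cst_oc (c s t : R) : s <= t ->
  (\int[mu]_(x in `]s, t]) c%:E = (c * (V t - V s))%:E)%E.
Proof.
move=> st; rewrite -[LHS]/(\int[mu]_(x in `]s, t]) (cst c%:E x))%E integral_cst //.
by rewrite EFinM; congr (_ * _)%E; exact: LS_oc.
Qed.

Lemma cvg_right_dominated (f : R -> R) (C : R) : (forall s t, s <= t ->
  `|f t - f s| <= C * (V t - V s)) -> right_continuous f.
Proof.
move=> fV x; apply: (@squeeze_cvgr _ _ _ _ (fun y => f x - C * (V y - V x))
    (fun y => f x + C * (V y - V x))).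
- near=> y; have xy : x <= y by apply: ltW; near: y; exact: nbhs_right_gt.
  have := fV _ _ xy; rewrite ler_norml; lra.
- rewrite -[X in _ --> X]subr0 -(mulr0 C) -(subrr (V x)).
  apply: cvgB; first exact: cvg_cst.
  apply: cvgM; first exact: cvg_cst.
  by apply: cvgB; [exact: cumulative_is_right_continuous|exact: cvg_cst].
- rewrite -[X in _ --> X]addr0 -(mulr0 C) -(subrr (V x)).
  apply: cvgD; first exact: cvg_cst.
  apply: cvgM; first exact: cvg_cst.
  by apply: cvgB; [exact: cumulative_is_right_continuous|exact: cvg_cst].
Unshelve. all: by end_near. Qed.

Lemma density_dominated (f g : R -> R) (C : R) :
  measurable_fun [set: measurableTypeR R] g -> (forall x, `|g x| <= C) ->
  (forall s t, s <= t -> (f t - f s)%:E = (\int[mu]_(x in `]s, t]) (g x)%:E)%E) ->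
  forall s t, s <= t -> `|f t - f s| <= C * (V t - V s).
Proof.
move=> mg gC fE s t st; rewrite -lee_fin -integral_cst_oc //.
rewrite (_ : `|f t - f s|%:E = `|(f t - f s)%:E|%E) // fE //.
apply: le_trans (le_abse_integral _ _ _) _ => //.
  exact/measurable_funTS/measurable_EFinP.
apply: ge0_le_integral => //.
- by apply: measurableT_comp => //; exact/measurable_funTS/measurable_EFinP.
- by move=> x _ /=; rewrite lee_fin.
Qed.

(** [V + f] and [V - f] are cumulative and their measures add up to [2 mu]. So the first has a
    density between 0 and 2, and subtracting 1 gives the density of [f]. *)
Lemma exists_density (f : R -> R) : (forall s t, s <= t ->
    `|f t - f s| <= V t - V s) ->
  exists g : R -> R, [/\ measurable_fun [set: measurableTypeR R] g,
    forall x, `|g x| <= 1 & forall s t, s <= t ->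
    (f t - f s)%:E = (\int[mu]_(x in `]s, t]) (g x)%:E)%E].
Proof.
move=> fV.
have frc : right_continuous f.
  by apply: (@cvg_right_dominated f 1) => s t st; rewrite mul1r; exact: fV.
have pnd : nondecreasing (fun x => V x + f x).
  by move=> s t st; have := fV s t st; rewrite ler_norml; lra.
have prc : right_continuous (fun x => V x + f x).
  by move=> x; apply: cvgD => //; exact: cumulative_is_right_continuous.
have nnd : nondecreasing (fun x => V x - f x).
  by move=> s t st; have := fV s t st; rewrite ler_norml; lra.
have nrc : right_continuous (fun x => V x - f x).
  by move=> x; apply: cvgB => //; exact: cumulative_is_right_continuous.
pose p := cumul_of pnd prc; pose n := cumul_of nnd nrc.
have pV A : measurable A -> (LS p A <= 2%:E * mu A)%E.
  move=> mA; have := @LS_add4 p n V V _ A mA.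
  rewrite -mule2n -mule_natl => <-; first by rewrite leeDl.
  by move=> a b _ /=; lra.
have [h [mh h2 hE]] := bounded_density (mu := mu) (ler0n R 2) pV.
exists (fun x => h x - 1); split.
- by apply: measurable_funB.
- by move=> x; have := h2 x; rewrite ler_norml; lra.
- move=> s t st.
  rewrite (eq_integral (fun x => (EFin \o h) x - (EFin \o cst (1 : R)%R) x)%E) //.
  rewrite integralB //; last 2 first.
  + apply: (@bounded_integrable_oc _ 2) => // x.
    by have := h2 x; rewrite ler_norml; lra.
  + by apply: (@bounded_integrable_oc _ 1) => // x; rewrite normr1.
  have -> : (\int[mu]_(x in `]s, t]) (EFin \o h) x = (p t - p s)%:E)%E.
    by transitivity (LS p `]s, t]%classic); [exact/esym/hE|exact: LS_oc].
  by rewrite integral_cst_oc // -EFinB /=; congr EFin; lra.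
Qed.

(** On [E] the signed measure [df = dp - dq] reduces to [dp]. Adding [C V] to [f] gives a cumulative
    function, so only positive measures are compared. The pointwise properties of the direction
    field are derived from this lemma. *)
Lemma density_ge0 (p q : cumulative R R) (f g : R -> R) (C : R) E :
  measurable E -> measurable_fun [set: measurableTypeR R] g ->
  (forall x, `|g x| <= C) ->
  (forall s t, s <= t -> (f t - f s)%:E = (\int[mu]_(x in `]s, t]) (g x)%:E)%E) ->
  (forall s t, s <= t -> f t - f s + (q t - q s) = p t - p s) ->
  LS q E = 0%E -> {ae mu, forall x, E x -> 0 <= g x}.
Proof.
move=> mE mg gC fE fqp qE0.
have C0 : 0 <= C by apply: le_trans (gC 0).
have KE s t : s <= t -> (f t + C * V t - (f s + C * V s))%:E =
    (\int[mu]_(x in `]s, t]) (g x + C)%:E)%E.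
  move=> st; rewrite (eq_integral
    (fun x : measurableTypeR R => (EFin \o g) x + (EFin \o cst C) x)%E) //.
  rewrite integralD //; last 2 first.
  + exact: (@bounded_integrable_oc _ C).
  + by apply: (@bounded_integrable_oc _ C) => // x; rewrite ger0_norm.
  by rewrite -fE // integral_cst_oc // -EFinD; congr EFin; lra.
have gC0 x : 0 <= g x + C by have := gC x; rewrite ler_norml; lra.
have knd : nondecreasing (fun x => f x + C * V x).
  move=> s t st; rewrite -subr_ge0 -lee_fin KE //.
  by apply: integral_ge0 => x _; rewrite lee_fin.
have krc : right_continuous (fun x => f x + C * V x).
  move=> x; apply: cvgD; last first.
    by apply: cvgM; [exact: cvg_cst|exact: cumulative_is_right_continuous].
  exact: (cvg_right_dominated (density_dominated mg gC fE)).
have Cn : C = (NngNum C0)%:num by [].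
pose K := cumul_of knd krc; pose CV := cumulZ (NngNum C0) V.
have KA A : measurable A -> LS K A = (\int[mu]_(x in A) (g x + C)%:E)%E.
  by apply: LS_density => //; exact: measurable_funD.
have CVA A : measurable A -> LS CV A = (\int[mu]_(x in A) C%:E)%E.
  apply: (@LS_density CV (cst C)) => // s t st.
  by rewrite integral_cst_oc //= mulrBr.
have : {ae mu, forall x, E x -> (C%:E <= (g x + C)%:E)%E}.
  apply: (@ae_le_of_integral _ _ _ mu E (cst C%:E) _ (C + C)) => //.
  - by apply/measurable_EFinP; exact: measurable_funD.
  - exact: addr_ge0.
  - by move=> x; rewrite !lee_fin gC0 lerD2r; have := gC x; rewrite ler_norml; lra.
  - move=> A mA AE; rewrite -CVA // -KA //.
    have -> : LS K A = (LS K A + LS q A)%E.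
      suff -> : LS q A = 0%E by rewrite adde0.
      by apply: (subset_measure0 mA mE AE).
    rewrite (@LS_add4 K q p CV) //; first by rewrite leeDr.
    by move=> s t st /=; have := fqp s t st; lra.
by apply: filterS => x H Ex; have := H Ex; rewrite lee_fin lerDr.
Qed.
End LSdensity.
End Cumulative.

(** * Total variation of vector valued paths *)

Section EuclideanNorm.
Context {R : realType} {A : finType}.
Implicit Types w x y : A -> R.

Lemma enorm_ge0 x : 0 <= enorm x.
Proof. exact: sqrtr_ge0. Qed.

Lemma enorm_sqr x : enorm x ^+ 2 = \sum_i x i ^+ 2.
Proof. by rewrite sqr_sqrtr // sumr_ge0 // => i _; exact: sqr_ge0. Qed.

Lemma enorm_eq0 x i : enorm x = 0 -> x i = 0.
Proof.
move=> x0; have := enorm_sqr x; rewrite x0 expr0n /= => /esym/eqP.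
rewrite psumr_eq0 => [/allP/(_ i)|j _]; last exact: sqr_ge0.
by rewrite mem_index_enum => /(_ isT); rewrite sqrf_eq0 => /eqP.
Qed.

Lemma enorm0 : enorm (fun _ : A => 0 : R) = 0.
Proof. by rewrite /enorm big1 ?sqrtr0 // => i _; rewrite expr0n. Qed.

Lemma dotp_le_enorm w y : dotp w y <= enorm w * enorm y.
Proof.
have [w0|w0] := eqVneq (enorm w) 0.
  by rewrite w0 mul0r /dotp big1 // => i _; rewrite (enorm_eq0 _ w0) mul0r.
have [y0|y0] := eqVneq (enorm y) 0.
  by rewrite y0 mulr0 /dotp big1 // => i _; rewrite (enorm_eq0 _ y0) mulr0.
have ab : 0 < enorm w * enorm y by rewrite mulr_gt0 // lt_def enorm_ge0 ?w0 ?y0.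
have : 0 <= \sum_i (enorm y * w i - enorm w * y i) ^+ 2.
  by apply: sumr_ge0 => i _; exact: sqr_ge0.
rewrite (eq_bigr (fun i => enorm y ^+ 2 * w i ^+ 2 + enorm w ^+ 2 * y i ^+ 2
   - 2 * (enorm w * enorm y) * (w i * y i))); last by move=> i _; ring.
rewrite sumrB big_split /= -!mulr_sumr -!enorm_sqr -/(dotp w y) => H.
rewrite -(ler_pM2l ab); nra.
Qed.

Lemma enormD x y : enorm (fun i => x i + y i) <= enorm x + enorm y.
Proof.
rewrite -(@ler_pXn2r _ 2) ?nnegrE ?addr_ge0 ?enorm_ge0 // enorm_sqr.
rewrite (eq_bigr (fun i => x i ^+ 2 + y i ^+ 2 + 2 * (x i * y i))); last first.
  by move=> i _; ring.
rewrite !big_split /= -mulr_sumr -!enorm_sqr -/(dotp x y).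
by have := dotp_le_enorm x y; nra.
Qed.

Lemma norm_le_enorm x i : `|x i| <= enorm x.
Proof.
rewrite -sqrtr_sqr; apply: ler_wsqrtr; rewrite (bigD1 i) //= lerDl.
by apply: sumr_ge0 => j _; exact: sqr_ge0.
Qed.

Lemma enorm_le_sum x : enorm x <= \sum_i `|x i|.
Proof.
have S0 : 0 <= \sum_i `|x i| by apply: sumr_ge0.
rewrite -(@ler_pXn2r _ 2) ?nnegrE ?enorm_ge0 // enorm_sqr expr2 mulr_suml.
apply: ler_sum => i _; rewrite -real_normK ?num_real // expr2 ler_wpM2l //.
by rewrite (bigD1 i) //= lerDl sumr_ge0.
Qed.
End EuclideanNorm.

(** * A Stieltjes measure does not charge the set where its function is locally flat *)

Section FlatNull.
Context {R : realType}.
Variables (q : cumulative R R) (f : R -> R).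
Hypothesis q_neg : forall t, t <= 0 -> q t = 0.
Hypothesis f_rc : forall t, 0 <= t -> f u @[u --> t^'+] --> f t.
Hypothesis q_flat : forall s t, 0 <= s -> s <= t ->
  (forall u, s <= u <= t -> 0 < f u) -> q t = q s.
Hypothesis q_left : forall t e, 0 < t -> 0 < f t -> 0 < e ->
  exists2 s, s < t & q t - e < q s.
Local Notation LS := (lebesgue_stieltjes_measure q).

Definition possupp : set R := [set t | 0 <= t /\ 0 < f t].

Let rat_seq (n : nat) : R := ratr (odflt 0 (unpickle n)).

Let rat_between (a b : R) : a < b -> exists n, a < rat_seq n < b.
Proof.
move=> /rat_in_itvoo[r]; rewrite in_itv /= => rab.
by exists (pickle r); rewrite /rat_seq pickleK.
Qed.

(** The positivity set of a right-continuous function need not be open, but each of its points lies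
    in such an interval with rational [r]. *)
Let piece (r : R) : set R :=
  [set t | [/\ 0 <= t, t < r & forall u, t <= u <= r -> 0 < f u]].

Let possuppE : possupp = \bigcup_n piece (rat_seq n).
Proof.
apply/seteqP; split=> [t [t0 ft]|t [n _ [t0 tr H]]]; last first.
  by split=> //; apply: H; rewrite lexx ltW.
have /near_rightP[d d0 H] : \forall u \near t^'+, 0 < f u.
  exact: cvgr_gt (f_rc t0) _ ft.
have [|n /andP[tn nd]] := @rat_between t (t + d); first by rewrite ltrDl.
exists n => //; split => // u /andP[tu un].
move: tu; rewrite le_eqVlt => /predU1P[<-//|tu].
by apply: H; rewrite tu (le_lt_trans un).
Qed.

Let piece_itv r : is_interval (piece r).
Proof.
move=> x y [x0 xr Hx] [y0 yr Hy] z /andP[xz zy]; split.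
- exact: le_trans xz.
- exact: le_lt_trans yr.
- by move=> u /andP[zu ur]; apply: Hx; rewrite (le_trans xz).
Qed.

Let point_null t : possupp t -> LS.-negligible [set t].
Proof.
move=> [t0 ft]; apply/negligibleP; first exact: measurable_set1.
apply/eqP; rewrite -measure_le0; apply/lee_addgt0Pr => e e0; rewrite add0e.
have [s st qs] : exists2 s, s < t & q t - e < q s.
  move: t0; rewrite le_eqVlt => /predU1P[<-|t0]; last exact: q_left.
  exists (-1); first by rewrite ltrN10.
  by rewrite !q_neg ?lerN10 // sub0r oppr_lt0.
apply: (@le_trans _ _ (LS `]s, t]%classic)).
  apply: le_measure; rewrite ?inE; [exact: measurable_set1|exact: measurable_itv|].
  by move=> _ ->; rewrite /= in_itv /= st lexx.
rewrite [leLHS](LS_oc q (ltW st)) lee_fin; lra.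
Qed.

Let piece_null_from (r a : R) : piece r a ->
  LS.-negligible (`]a, r]%classic : set R).
Proof.
move=> [a0 ar H]; apply/negligibleP; first exact: measurable_itv.
by transitivity ((q r - q a)%:E); [exact/LS_oc/ltW|rewrite (q_flat a0 (ltW ar) H) subrr].
Qed.

(** A least element of the interval might carry an atom, which [q_left] excludes; without a least
    element the interval is exhausted by intervals []a, r]] with rational [a]. *)
Let piece_null r : LS.-negligible (piece r).
Proof.
have [[a Ea amin]|nomin] := pselect (exists2 a, piece r a &
    forall t, piece r t -> a <= t).
  have Pa : possupp a.
    by have [a0 ar H] := Ea; split=> //; apply: H; rewrite lexx ltW.
  apply: negligibleS (negligibleU (point_null Pa) (piece_null_from Ea)).
  move=> t Et; have [t0 tr _] := Et; have := amin t Et.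
  rewrite le_eqVlt => /predU1P[->|at_]; [by left|right].
  by rewrite /= in_itv /= at_ ltW.
pose F n : set R := [set t | piece r (rat_seq n) /\ `]rat_seq n, r]%classic t].
have sub : piece r `<=` \bigcup_n F n.
  move=> t Et; have [s [Es st]] : exists s, piece r s /\ s < t.
    apply: contrapT => H; apply: nomin; exists t => // s Es.
    by rewrite leNgt; apply/negP => st; apply: H; exists s.
  have [n /andP[sn nt]] := rat_between st.
  exists n => //; split.
    by apply: (piece_itv Es Et); rewrite !ltW.
  by rewrite /= in_itv /= nt; have [_ /ltW] := Et.
apply: (@negligibleS _ _ _ LS _ _ sub); apply: negligible_bigcup => n.
have [En|En] := pselect (piece r (rat_seq n)).
  by apply: negligibleS (piece_null_from En) => t [].
by apply: negligibleS (negligible_set0 _) => t [].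
Qed.

Lemma measurable_possupp : measurable possupp.
Proof.
rewrite possuppE; apply: bigcup_measurable => n _.
exact: is_interval_measurable.
Qed.

Lemma possupp_null : LS possupp = 0%E.
Proof.
apply: measure_negligible; first exact: measurable_possupp.
by rewrite possuppE; apply: negligible_bigcup => n; exact: piece_null.
Qed.
End FlatNull.

Section TotalVariation.
Context {R : realType} {A : finType}.
Variable eta : R -> A -> R.

Definition dist_eta (s t : R) : R := enorm (fun i => eta t i - eta s i).

Fixpoint pvar (x : R) (l : seq R) : R :=
  if l is y :: l' then dist_eta x y + pvar y l' else 0.

Lemma vec_variation_pvar t l : vec_variation eta t l = pvar 0 l.
Proof.
suff H x : \sum_(0 <= n < size l) enorm (fun i =>
    eta (nth t (x :: l) n.+1) i - eta (nth t (x :: l) n) i) = pvar x l by exact: H.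
elim: l x => [|y l IH] x; first by rewrite big_geq.
by rewrite [size _]/= big_nat_recl // /= -IH.
Qed.

Lemma pvar_rcons x l t : pvar x (rcons l t) = pvar x l + dist_eta (last x l) t.
Proof.
by elim: l x => [|y l IH] x /=; rewrite ?addr0 ?add0r // IH addrA.
Qed.

Lemma dist_eta_ge0 s t : 0 <= dist_eta s t.
Proof. exact: sqrtr_ge0. Qed.

Lemma dist_etaxx s : dist_eta s s = 0.
Proof.
by rewrite /dist_eta /enorm big1 ?sqrtr0 // => i _; rewrite subrr expr0n.
Qed.

Lemma pvar_le (w : R -> R) : (forall s t, 0 <= s -> s <= t ->
    dist_eta s t <= w t - w s) ->
  forall x l, 0 <= x -> path <%R x l -> pvar x l <= w (last x l) - w x.
Proof.
move=> H x l; elim: l x => [|y l IH] x x0 /=; first by rewrite subrr.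
move=> /andP[xy pl]; have := IH y (ltW (le_lt_trans x0 xy)) pl.
by have := H x y x0 (ltW xy); lra.
Qed.

Variable rho : R -> R.
Hypothesis eta_rho : forall s t, 0 <= s -> s <= t ->
  dist_eta s t <= rho t - rho s.
Hypothesis rho_rc : forall t, 0 <= t -> rho u @[u --> t^'+] --> rho t.

Definition variations_of t : set R :=
  [set pvar 0 l | l in itv_partition 0 t].

Let has_sup_variations t : 0 <= t -> has_sup (variations_of t).
Proof.
move=> t0; split.
  move: t0; rewrite le_eqVlt => /predU1P[<-|t0].
    by exists (pvar 0 [::]), [::].
  by exists (pvar 0 [:: t]), [:: t] => //; rewrite /itv_partition /= t0 eqxx.
exists (rho t - rho 0) => _ [l [pl /eqP lt] <-].
by rewrite -lt; exact: pvar_le.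
Qed.

Definition tvar t : R := if t < 0 then 0 else sup (variations_of t).

Lemma tvar_neg t : t < 0 -> tvar t = 0.
Proof. by rewrite /tvar => ->. Qed.

Lemma vec_total_variation_tvar t : 0 <= t ->
  vec_total_variation eta t = (tvar t)%:E.
Proof.
move=> t0; rewrite /tvar ltNge t0 /=.
have [V0 Vu] := has_sup_variations t0.
rewrite -ereal_sup_EFin //; congr ereal_sup.
apply/seteqP; split=> _ [l pl <-].
  by exists (pvar 0 l); [exists l|rewrite vec_variation_pvar].
by case: pl => l' pl' <-; exists l' => //; rewrite vec_variation_pvar.
Qed.

Lemma tvar_le (w : R -> R) t : (forall s t, 0 <= s -> s <= t ->
    dist_eta s t <= w t - w s) -> 0 <= t -> tvar t <= w t - w 0.
Proof.
move=> H t0; rewrite /tvar ltNge t0 /=.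
apply: ge_sup; first by have [] := has_sup_variations t0.
by move=> _ [l [pl /eqP lt] <-]; rewrite -lt; exact: pvar_le.
Qed.

Lemma tvar_dist s t : 0 <= s -> s <= t -> dist_eta s t <= tvar t - tvar s.
Proof.
move=> s0; rewrite le_eqVlt => /predU1P[<-|st].
  by rewrite dist_etaxx subrr.
have t0 : 0 <= t by exact: ltW (le_lt_trans s0 st).
rewrite lerBrDr -lerBrDl /tvar !ltNge s0 t0 /=.
apply: ge_sup; first by have [] := has_sup_variations s0.
move=> _ [l [pl /eqP lt] <-]; rewrite lerBrDl.
apply: ub_le_sup; first by have [] := has_sup_variations t0.
exists (rcons l t); last by rewrite pvar_rcons lt addrC.
by split; rewrite ?last_rcons // rcons_path pl lt.
Qed.

Let dist_tri s t u : 0 <= t -> t <= u ->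
  dist_eta s u <= dist_eta s t + (rho u - rho t).
Proof.
move=> t0 tu; apply: (@le_trans _ _ (dist_eta s t + dist_eta t u)); last first.
  by rewrite lerD2l eta_rho.
apply: le_trans (enormD _ _).
by rewrite le_eqVlt; apply/predU1P; left; congr enorm; apply/funext => i; ring.
Qed.

(** Cuts a partition at [s]: the step across [s] is split by the triangle inequality, and all that
    comes after [s] is bounded by the increment of [rho]. *)
Let pvar_split x s l : 0 <= x -> x <= s -> path <%R x l -> s <= last x l ->
  exists l', [/\ path <%R x l', last x l' = s &
    pvar x l <= pvar x l' + (rho (last x l) - rho s)].
Proof.
elim: l x => [|y l IH] x x0 xs /=.
  move=> _ sx; have -> : s = x by apply/eqP; rewrite eq_le sx.
  by exists [::]; split => //=; rewrite subrr addr0.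
move=> /andP[xy pl] sl; have y0 : 0 <= y by exact: ltW (le_lt_trans x0 xy).
have [ys|sy] := leP y s.
  have [l' [pl' ll' H]] := IH y y0 ys pl sl.
  by exists (y :: l'); split => //=; [rewrite xy|rewrite -addrA lerD2l].
have H := pvar_le eta_rho y0 pl.
have s0 := le_trans x0 xs; have D := dist_tri x s0 (ltW sy).
move: xs; rewrite le_eqVlt => /predU1P[E|xs].
  exists [::]; split => //=; move: D; rewrite E dist_etaxx; lra.
by exists [:: s]; split; rewrite //= ?xs //; lra.
Qed.

(** Domination by the increments of [rho] is what makes the total variation right-continuous. *)
Lemma tvar_le_rho s t : 0 <= s -> s <= t -> tvar t - tvar s <= rho t - rho s.
Proof.
move=> s0 st; have t0 := le_trans s0 st.
rewrite lerBlDr /tvar !ltNge s0 t0 /=.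
apply: ge_sup; first by have [] := has_sup_variations t0.
move=> _ [l [pl /eqP lt] <-].
have [|l' [pl' ll' H]] := pvar_split (lexx 0) s0 pl; first by rewrite lt.
rewrite -lt addrC; apply: le_trans H _; rewrite lerD2r.
apply: ub_le_sup; first by have [] := has_sup_variations s0.
by exists l' => //; split => //; rewrite ll'.
Qed.

Lemma tvar0 : tvar 0 = 0.
Proof.
apply/eqP; rewrite eq_le; apply/andP; split.
  by have := tvar_le eta_rho (lexx 0); rewrite subrr.
rewrite /tvar ltxx; apply: ub_le_sup; first by have [] := has_sup_variations (lexx 0).
by exists [::].
Qed.

Lemma tvar_nondecreasing : nondecreasing tvar.
Proof.
move=> s t st; have [s0|s0] := ltP s 0; last first.
  rewrite -subr_ge0; apply: le_trans (tvar_dist s0 st); exact: dist_eta_ge0.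
rewrite tvar_neg //; have [t0|t0] := ltP t 0; first by rewrite tvar_neg.
rewrite -tvar0 -subr_ge0; apply: le_trans (tvar_dist (lexx 0) t0).
exact: dist_eta_ge0.
Qed.

Lemma tvar_right_continuous : right_continuous tvar.
Proof.
move=> t; have [t0|t0] := ltP t 0.
  rewrite tvar_neg //; apply: cvg_near_cst; near=> u; apply: tvar_neg.
  by near: u; exact: nbhs_right_lt.
apply: (@squeeze_cvgr _ _ _ _ (fun _ => tvar t)
    (fun y => tvar t + (rho y - rho t))).
- near=> y; have ty : t <= y by apply: ltW; near: y; exact: nbhs_right_gt.
  by rewrite tvar_nondecreasing //= -lerBlDl tvar_le_rho.
- exact: cvg_cst.
- rewrite -[X in _ --> X]addr0 -(subrr (rho t)).
  apply: cvgD; first exact: cvg_cst.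
  by apply: cvgB; [exact: rho_rc|exact: cvg_cst].
Unshelve. all: by end_near. Qed.

Definition tvar_cumulative := cumul_of tvar_nondecreasing tvar_right_continuous.
End TotalVariation.

(** * Increments of solutions of the Skorokhod problem *)

Section IncrementDensity.
Context {R : realType}.
Variable V : cumulative R R.
Local Notation mu := (lebesgue_stieltjes_measure V).
Implicit Types (f g : R -> R) (s t C : R).

Lemma ae_LSS (P Q : R -> Prop) : (forall x, P x -> Q x) ->
  {ae mu, forall x : R, P x} -> {ae mu, forall x : R, Q x}.
Proof.
move=> PQ; apply: (@negligibleS _ _ _ mu) => x nQ Px; exact/nQ/PQ.
Qed.

Lemma ae_LSI (P Q : R -> Prop) : {ae mu, forall x : R, P x} ->
  {ae mu, forall x : R, Q x} -> {ae mu, forall x : R, P x /\ Q x}.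
Proof.
move=> aP aQ; apply: (@negligibleS _ _ _ mu _ _ _ (negligibleU aP aQ)).
by move=> x /= /not_andP[]; [left|right].
Qed.

Lemma ae_LS_forall (I : countType) (P : I -> R -> Prop) :
  (forall i, {ae mu, forall x : R, P i x}) ->
  {ae mu, forall x : R, forall i, P i x}.
Proof.
move=> H.
have K : {ae mu, forall x : R, forall n i, unpickle n = Some i -> P i x}.
  apply: ae_foralln => n; case: (unpickle n) => [i|].
    by apply: ae_LSS (H i) => x Px j [<-].
  by apply: aeW => x i.
by apply: ae_LSS K => x Kx i; exact: Kx (pickleK i).
Qed.

Lemma integralB_oc f g C s t :
  measurable_fun [set: measurableTypeR R] f -> (forall x, `|f x| <= C) ->
  measurable_fun [set: measurableTypeR R] g -> (forall x, `|g x| <= C) ->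
  (\int[mu]_(x in `]s, t]) (f x - g x)%:E =
   \int[mu]_(x in `]s, t]) (f x)%:E - \int[mu]_(x in `]s, t]) (g x)%:E)%E.
Proof.
move=> mf fC mg gC.
rewrite (eq_integral (fun x : measurableTypeR R => (EFin \o f) x - (EFin \o g) x)%E) //.
rewrite integralB //.
- exact: (bounded_integrable_oc _ _ _ mf fC).
- exact: (bounded_integrable_oc _ _ _ mg gC).
Qed.

Lemma measurable_dotp {A : finType} (w : A -> R) (g : R -> A -> R) :
  (forall i, measurable_fun [set: measurableTypeR R] (g ^~ i)) ->
  measurable_fun [set: measurableTypeR R] (fun x => dotp w (g x)).
Proof.
by move=> mg; apply: measurable_sum => i; exact: measurable_funM.
Qed.

Lemma norm_dotp_le {A : finType} (w : A -> R) (x : A -> R) C :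
  (forall i, `|x i| <= C) -> `|dotp w x| <= (\sum_i `|w i|) * C.
Proof.
move=> xC; apply: le_trans (ler_norm_sum _ _ _) _; rewrite mulr_suml.
by apply: ler_sum => i _; rewrite normrM ler_wpM2l.
Qed.

Lemma dotp_density {A : finType} (w : A -> R) (f g : R -> A -> R) C s t :
  (forall i, measurable_fun [set: measurableTypeR R] (g ^~ i)) ->
  (forall x i, `|g x i| <= C) ->
  (forall i, (f t i - f s i)%:E = (\int[mu]_(x in `]s, t]) (g x i)%:E)%E) ->
  (dotp w (fun i => f t i - f s i))%:E =
    (\int[mu]_(x in `]s, t]) (dotp w (g x))%:E)%E.
Proof.
move=> mg gC fE; rewrite /dotp.
rewrite (eq_integral (fun x : measurableTypeR R =>
   \sum_i (EFin \o (fun y : R => (w i * g y i)%R)) x)%E); last first.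
  by move=> x _; rewrite sumEFin.
rewrite integral_sum //; last first.
  move=> i; apply: (@bounded_integrable_oc _ _ _ (`|w i| * C)).
    exact: measurable_funM.
  by move=> x; rewrite normrM ler_wpM2l.
rewrite -sumEFin; apply: eq_bigr => i _.
rewrite EFinM fE -integralZl //.
exact: (bounded_integrable_oc _ _ _ (mg i) (gC^~ i)).
Qed.

Lemma ae_le_integral_oc f g C s t :
  measurable_fun [set: measurableTypeR R] f -> (forall x, `|f x| <= C) ->
  measurable_fun [set: measurableTypeR R] g -> (forall x, `|g x| <= C) ->
  {ae mu, forall x, `]s, t]%classic x -> f x <= g x} ->
  (\int[mu]_(x in `]s, t]) (f x)%:E <= \int[mu]_(x in `]s, t]) (g x)%:E)%E.
Proof.
move=> mf fC mg gC fg.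
have mm : measurable_fun [set: measurableTypeR R] (fun x => Num.min (f x) (g x)).
  exact: measurable_minr.
have mC x : `|Num.min (f x) (g x)| <= C.
  by have := fC x; have := gC x; rewrite /Num.min; case: ifP.
have fg' : {ae mu, forall x, `]s, t]%classic x ->
    (f x)%:E = (Num.min (f x) (g x))%:E}.
  by apply: ae_LSS fg => x H xst; congr EFin; apply/esym/min_idPl/H.
have -> : (\int[mu]_(x in `]s, t]) (f x)%:E =
    \int[mu]_(x in `]s, t]) (Num.min (f x) (g x))%:E)%E.
  apply: ae_eq_integral => //.
  - exact/measurable_funTS/measurable_EFinP.
  - exact/measurable_funTS/measurable_EFinP.
apply: le_integral => //.
- exact: (bounded_integrable_oc _ _ _ mm mC).
- exact: (bounded_integrable_oc _ _ _ mg gC).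
- by move=> x _; rewrite lee_fin ge_min lexx orbT.
Qed.

(** The open intervals []u, t[] decrease to the empty set, even if [t] carries an atom. *)
Lemma mu_oo_left t e : 0 < e ->
  \forall u \near t^'-, (mu `]u, t[%classic < e%:E)%E.
Proof.
move=> e0; pose F n : set R := `]t - n.+1%:R^-1, t[%classic.
have mF n : measurable (F n) by exact: measurable_itv.
have F0 : (mu (F 0%N) < +oo)%E.
  apply: (@le_lt_trans _ _ (mu `]t - 1, t]%classic)).
    apply: le_measure; rewrite ?inE; [exact: mF|exact: measurable_itv|].
    by move=> x; rewrite /F /= !in_itv /= invr1 => /andP[-> /ltW].
  by rewrite [X in (X < _)%E](LS_oc V) ?ltry // gerBl.
have cap : \bigcap_n F n = set0.
  rewrite -subset0 => x Fx; have := Fx 0%N I; rewrite /F /= in_itv /= => /andP[_ xt].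

  have tx : 0 < t - x by rewrite subr_gt0.
  have [n _ /(_ n (leqnn n)) H] := near_infty_natSinv_lt (PosNum tx).
  have := Fx n I; rewrite /F /= in_itv /= => /andP[xn _].
  by move: xn; rewrite ltNge => /negP[]; rewrite lerBrDr addrC -lerBrDr; exact: ltW.
have Fd : {homo F : n m / (n <= m)%N >-> (m <= n)%O}.
  move=> n m nm; apply/subsetPset => x; rewrite /F /= !in_itv /= => /andP[a ->].
  rewrite andbT; apply: le_lt_trans a.
  by rewrite lerD2l lerN2 lef_pV2 ?posrE // ler_nat.
have mcap : measurable (\bigcap_n F n) by rewrite cap; exact: measurable0.
have := @nonincreasing_cvg_mu _ _ _ mu F F0 mF mcap Fd.
rewrite cap measure0 => H.
have [N _ HN] : \forall n \near \oo, (mu (F n) < e%:E)%E.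
  by apply: (H [set x | (x < e%:E)%E]); apply: open_ereal_lt'; rewrite lte_fin.
near=> u; apply: le_lt_trans (HN N (leqnn N)).
apply: le_measure; rewrite ?inE; [exact: measurable_itv|exact: mF|].
move=> x; rewrite /F /= !in_itv /= => /andP[ux ->]; rewrite andbT.
apply: lt_trans ux; near: u; apply: nbhs_left_gt.
by rewrite gtrBl.
Unshelve. all: by end_near. Qed.
End IncrementDensity.

Section SPPushes.
Context {R : realType} {A : finType}.
Variable b : A -> R.
Hypothesis b_gt0 : forall i, 0 < b i.
Hypothesis b_sum1 : \sum_i b i = 1.

(** The density lies in the cone, so an increment integrates a nonpositive function. For the jump
    only the atom at [t] counts, because the measure of []u, t[] tends to 0. *)
Lemma gps_SP_pushes T (psi phi eta : R -> A -> R) :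
  gps_SP b psi phi eta -> gps_pushes b T phi eta.
Proof.
move=> [_ ceta _ _ [v [_ _ _ [g [mg gae etaE]]]]].
set mu := lebesgue_stieltjes_measure v in gae etaE.
(* [g] is measurable on [[0, +oo[] only and bounded almost everywhere only. Its truncation [G] is
   measurable and bounded everywhere, and equals [g] at almost every nonnegative time since
   [enorm g = 1] there. *)
pose G x i := Num.max (-1) (Num.min 1 (((g^~ i) \_ `[0, +oo[%classic) x)).
have mD : measurable (`[0, +oo[%classic : set (measurableTypeR R)).
  exact: measurable_itv.
have mG i : measurable_fun [set: measurableTypeR R] (G^~ i).
  apply: measurable_maxr => //; apply: measurable_minr => //.
  exact: (measurable_restrictT (g^~ i) mD).1 (mg i).
have G1 x i : `|G x i| <= 1.
  rewrite /G ler_norml le_max lexx /= ge_max ge_min lexx andbT.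
  exact: le_trans (lerN10 R) ler01.
have GE : {ae mu, forall x, 0 <= x -> gps_cone b (phi x) (G x) /\ G x = g x}.
  apply: ae_LSS gae => x H x0; have [gx g1] := H x0.
  suff E : G x = g x by rewrite E.
  apply/funext => i; rewrite /G patchE mem_set; last by rewrite /= in_itv /= x0.
  have := norm_le_enorm (g x) i; rewrite g1 ler_norml => /andP[a1 a2].
  by rewrite (min_idPr a2) (max_idPr a1).
have etaG (t : R) (j : A) : 0 <= t ->
    (eta t j)%:E = (\int[mu]_(s in `[0%R, t]) (G s j)%:E)%E.
  move=> t0; rewrite etaE //; apply: ae_eq_integral => //.
  - apply/measurable_EFinP; apply: (measurable_funS mD _ (mg j)).
    by move=> x; rewrite /= !in_itv /= => /andP[->].
  - exact/measurable_funTS/measurable_EFinP.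
  - apply: ae_LSS GE => x H; rewrite /= in_itv /= => /andP[x0 _].
    by have [_ ->] := H x0.
have etaI s t i : 0 <= s -> s <= t ->
    (eta t i - eta s i)%:E = (\int[mu]_(x in `]s, t]) (G x i)%:E)%E.
  move=> s0 st; have := etaG t i (le_trans s0 st).
  rewrite (_ : `[0, t]%classic = `[0, s]%classic `|` `]s, t]%classic); last first.
    by rewrite -itv_bndbnd_setU // bnd_simp.
  rewrite integral_setU //; last 2 first.
  - exact/measurable_funTS/measurable_EFinP.
  - apply/disj_setPS => x; rewrite /= !in_itv /= => -[/andP[_ xs] /andP[sx _]].
    by have := le_lt_trans xs sx; rewrite ltxx.
  rewrite -etaG //; case: (integral _ _ _) => // r.
  by rewrite -EFinD => -[->]; congr EFin; rewrite addrC addKr.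
have dotI w s t : 0 <= s -> s <= t ->
    (dotp w (fun i => eta t i - eta s i))%:E =
    (\int[mu]_(x in `]s, t]) (dotp w (G x))%:E)%E.
  by move=> s0 st; apply: (dotp_density w mG G1) => i; exact: etaI.
have GC w x : `|dotp w (G x)| <= \sum_i `|w i|.
  by rewrite -[leRHS]mulr1; exact: norm_dotp_le.
split=> [w s t s0 st _ wu|w t t0 _ wt].
  rewrite -lee_fin dotI //; last exact: ltW.
  rewrite -[leRHS](@integral0 _ _ _ mu `]s, t]%classic).
  apply: (@ae_le_integral_oc _ _ _ (cst 0) (\sum_i `|w i|)) => //.
  - exact: measurable_dotp.
  - by move=> x; rewrite normr0 sumr_ge0.
  - apply: ae_LSS GE => x H; rewrite /= in_itv /= => /andP[sx xt].
    have [cx _] := H (le_trans s0 (ltW sx)).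
    by apply: gps_cone_polar cx => //; apply: wu; rewrite sx.
set c := \sum_i `|w i|.
have c0 : 0 <= c by exact: sumr_ge0.
(* On []u, t[] the integrand is at most [c]; at [t] it is nonpositive by the polar condition. *)
have key u : 0 <= u -> u < t ->
    ((dotp w (fun i => eta t i - eta u i))%:E <= c%:E * mu `]u, t[%classic)%E.
  move=> u0 ut; rewrite dotI //; last exact: ltW.
  have mo : measurable (`]u, t[%classic : set (measurableTypeR R)).
    exact: measurable_itv.
  have mc : measurable (`]u, t]%classic : set (measurableTypeR R)).
    exact: measurable_itv.
  have mI : measurable_fun [set: measurableTypeR R]
     (fun x => c * \1_(`]u, t[%classic : set (measurableTypeR R)) x).
    by apply: measurable_funM => //; exact: measurable_indic.
  have IC x : `|c * \1_(`]u, t[%classic : set (measurableTypeR R)) x| <= c.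
    by rewrite normrM ger0_norm // ler_piMr // indicE; case: (_ \in _); rewrite ?normr1 ?normr0.
  apply: le_trans (ae_le_integral_oc (measurable_dotp w mG) (GC w) mI IC _) _.
    apply: ae_LSS GE => x H; rewrite /= in_itv /= => /andP[ux].
    rewrite le_eqVlt => /predU1P[xt|xt].
      have [cx _] := H (ltW (le_lt_trans u0 ux)).
      rewrite xt in cx *; apply: le_trans (gps_cone_polar b_gt0 b_sum1 wt cx) _.
      by rewrite mulr_ge0 // indicE; case: (_ \in _).
    rewrite indicE mem_set ?mulr1; last by rewrite /= in_itv /= ux xt.
    by apply: le_trans (GC w x); exact: ler_norm.
  rewrite (eq_integral (fun x : measurableTypeR R => (c%:E *
      (\1_(`]u, t[%classic : set (measurableTypeR R)) x)%:E)%E)) //.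
  rewrite ge0_integralZl_EFin //; last by apply/measurable_EFinP; exact: measurable_indic.
  rewrite integral_indic ?lee_wpmul2l // ?lee_fin //.
  apply: le_measure; rewrite ?inE; [exact: measurableI|exact: mo|].
  by move=> x [].
apply/ler_addgt0Pr => e e0; rewrite add0r.
apply: (@cvgr_to_le _ (t^'-) _ R (fun u => dotp w (fun i => eta t i - eta u i))).
  by apply: dotp_cvg => i; apply: cvgB; [exact: cvg_cst|exact: cadlag_left].
have ec : 0 < e / (c + 1) by rewrite divr_gt0 // ltr_wpDl.
near=> u.
have u0 : 0 <= u by apply: ltW; near: u; exact: nbhs_left_gt.
have ut : u < t by near: u; exact: nbhs_left_lt.
have mu_e : (mu `]u, t[%classic < (e / (c + 1))%:E)%E.
  by near: u; exact: mu_oo_left.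
rewrite -lee_fin; apply: le_trans (key u u0 ut) _.
apply: (@le_trans _ _ (c%:E * (e / (c + 1))%:E)%E).
  by rewrite lee_wpmul2l ?lee_fin // ltW.
rewrite -EFinM lee_fin mulrCA ler_piMr //; first exact: ltW.
by rewrite ler_pdivrMr ?mul1r ?lerDl // ltr_wpDl.
Unshelve. all: by end_near. Qed.
End SPPushes.

(** * Construction of a solution of the Skorokhod problem *)

Section ConeMembership.
Context {R : realType} {A : finType}.
Variable b : A -> R.
Hypothesis b_gt0 : forall i, 0 < b i.
Hypothesis b_sum1 : \sum_i b i = 1.
Implicit Types x y z : A -> R.

Lemma gps_dirE i j : (1 - b i) * gps_dir b i j = (j == i)%:R - b j.
Proof.
rewrite /gps_dir; have [->|ji] := eqVneq j i; first by rewrite mulr1.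
have [bi1|bi1] := eqVneq (b i) 1.
  by move: ji; rewrite (weight_eq1 b_gt0 b_sum1 bi1 j) eqxx.
by rewrite sub0r; field; rewrite subr_eq0 eq_sym.
Qed.

Lemma sum_gps_dir (c : A -> R) (P : pred A) j :
  (forall i, ~~ P i -> c i = 0) ->
  \sum_(i | P i) c i * (1 - b i) * gps_dir b i j = c j - b j * \sum_i c i.
Proof.
move=> c0; under eq_bigr do rewrite -mulrA gps_dirE.
have -> : c j - b j * \sum_i c i = \sum_i c i * ((j == i)%:R - b j).
  under [RHS]eq_bigr do rewrite mulrBr.
  rewrite sumrB -mulr_suml mulrC; congr (_ - _).
  rewrite (bigD1 j) //= eqxx mulr1 big1 ?addr0 // => i ij.
  by rewrite eq_sym (negbTE ij) mulr0.
rewrite [RHS](bigID P) /= [X in _ = _ + X]big1 ?addr0 // => i Pi.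
by rewrite c0 // mul0r.
Qed.

(** Finitely many linear inequalities, a form in which membership of a density can be checked almost
    everywhere. Each coordinate with [x j > 0] minimises [y i / b i]; subtracting this minimum times
    [b] from [y] leaves nonnegative coefficients that vanish wherever [x] is positive. *)
Lemma gps_coneI x y : orthant x -> 0 <= \sum_i y i ->
  (forall j, 0 < x j ->
    \sum_i y i <= 0 /\ forall i, 0 <= b j * y i - b i * y j) ->
  gps_cone b x y.
Proof.
move=> x0 y0 H; have [[j xj]|xE] := pselect (exists j, x j != 0).
  have xj0 : 0 < x j by rewrite lt_def xj x0.
  have [Sy yj] := H j xj0.
  have S0 : \sum_i y i = 0 by apply/eqP; rewrite eq_le Sy.
  pose c i := y i - b i * (y j / b j).
  have bcE i : b j * c i = b j * y i - b i * y j.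
    by rewrite /c; field; rewrite gt_eqF.
  have cge0 i : 0 <= c i by rewrite -(pmulr_rge0 _ (b_gt0 j)) bcE.
  have c0 i : ~~ (x i == 0) -> c i = 0.
    move=> xi; have xi0 : 0 < x i by rewrite lt_def xi x0.
    have [_ /(_ j) yi] := H i xi0; have := yj i.
    have /eqP := bcE i; rewrite -subr_eq0 => /eqP E1 E2.
    apply/eqP; rewrite eq_le cge0 andbT -(pmulr_rle0 _ (b_gt0 j)) bcE.
    by lra.
  exists (fun i => c i * (1 - b i)), 0; split=> // [i|k].
    by rewrite mulr_ge0 // subr_ge0 weight_le1.
  rewrite mul0r addr0 sum_gps_dir // /c sumrB -mulr_suml S0 b_sum1.
  by ring.
have {}xE i : x i = 0 by apply/eqP/negP => /negP xi; apply: xE; exists i.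
pose n : R := #|A|%:R.
have n0 : 0 < n.
  have [i0 _] : exists i : A, True.
    apply: contrapT => H0; move: b_sum1; rewrite big1 => [/esym/eqP|i _].
      by rewrite oner_eq0.
    by case: H0; exists i.
  by rewrite ltr0n; apply/card_gt0P; exists i0.
(* At the origin the mean of [y] goes to [gps_dir_origin], and the remainder [z] has sum 0. Adding a
   multiple of [b] makes the coefficients nonnegative and does not change the combination, because
   [c - b * sum c] vanishes for [c = b]. *)
pose s := (\sum_i y i) / n; pose z i := y i - s.
have z0 : \sum_i z i = 0.
  by rewrite sumrB sumr_const -mulr_natr -/n divfK ?subrr // gt_eqF.
pose M := \sum_i `|z i| / b i.
pose c i := z i + b i * M.
have cge0 i : 0 <= c i.
  have : `|z i| / b i <= M.
    rewrite /M (bigD1 i) //= lerDl sumr_ge0 // => k _.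
    by rewrite divr_ge0 // ltW.
  rewrite ler_pdivrMr // => zM; have := ler_norm (- z i).
  by rewrite normrN /c; lra.
exists (fun i => c i * (1 - b i)), (s * Num.sqrt n); split.
- by move=> i; rewrite mulr_ge0 // subr_ge0 weight_le1.
- by rewrite mulr_ge0 ?sqrtr_ge0 // divr_ge0 // ltW.
- by move=> [i]; rewrite xE eqxx.
move=> k; rewrite sum_gps_dir; last by move=> i; rewrite xE eqxx.
rewrite /gps_dir_origin -/n mulfK ?sqrtr_eq0 -?ltNge //.
rewrite /c big_split /= z0 -mulr_suml b_sum1 /z; ring.
Qed.

Lemma orthant_boundaryP x : orthant x ->
  orthant_boundary x <-> exists i, x i = 0.
Proof.
move=> x0; split=> [[_ nint]|[i xi]].
  apply: contrapT => /forallNP xn; apply: nint.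
  have xpos i : 0 < x i by rewrite lt_def x0 andbT; exact/eqP/xn.
  have H i : \forall z \near (x : {ptws A -> R}), 0 < z i.
    pose y : {ptws A -> R} := x.
    have P : (fun z : {ptws A -> R} => z i : R) @ y --> (y i : R).
      exact: (@proj_continuous A (fun=> R) i y).
    exact: (P _ (lt_nbhsr (xpos i))).
  have Hall := @filter_forall {ptws A -> R} A
    (fun i => [set z : {ptws A -> R} | 0 < z i]) (nbhs (x : {ptws A -> R}))
    (nbhs_filter (x : {ptws A -> R})) H.
  have sub : (fun z : {ptws A -> R} => forall i : A, 0 < z i) `<=` @orthant R A.
    by move=> z Hz i; exact: ltW.
  exact: (@filterS _ _ (nbhs_filter (x : {ptws A -> R})) _ _ sub Hall).
split; first exact: subset_closure.
move=> xint.
pose F : R -> {ptws A -> R} := @dfwith A (fun=> R) x i.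
have F0 : F 0 = x.
  by apply/funext => k; rewrite /F; case: dfwithP => //; rewrite xi.
have Fc : F r @[r --> (0 : R)] --> F 0.
  exact: (@dfwith_continuous A (fun=> R) x i 0).
rewrite -F0 in xint.
have [e /= e0 He] : \forall r \near (0 : R), orthant (F r) := Fc _ xint.
have := He (- (e / 2)); rewrite /ball_ /= sub0r opprK gtr0_norm ?divr_gt0 //.
have e2 : e / 2 < e by rewrite gtr_pMr // invf_lt1 // ltr1n.
move=> /(_ e2 i); rewrite /F dfwithin oppr_ge0 leNgt.
by rewrite divr_gt0.
Qed.
End ConeMembership.

Section MoreCvg.
Context {R : realType}.

Lemma nondecreasing_left_cvg (f : R -> R) (t : R) : nondecreasing f ->
  cvg (f u @[u --> t^'-]).
Proof.
move=> nd; apply: nondecreasing_at_left_is_cvgr.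
  by near=> v => x y _ _; exact: nd.
near=> v; exists (f t) => _ [x /= + <-]; rewrite in_itv /= => /andP[_ xt].
exact/nd/ltW.
Unshelve. all: by end_near. Qed.
End MoreCvg.

Section SkorokhodFromRegulators.
Context {R : realType} {A : finType}.
Variables (b : A -> R) (psi : R -> A -> R).
Variables (rho : A -> cumulative R R) (L : cumulative R R).
Hypothesis b_gt0 : forall i, 0 < b i.
Hypothesis b_sum1 : \sum_i b i = 1.
Hypothesis psi_cadlag : cadlag psi.
Hypothesis rho_neg : forall t i, t <= 0 -> rho i t = 0.
Hypothesis L_neg : forall t, t <= 0 -> L t = 0.

(** Each [rho j] pushes along [e_j - b], a nonnegative multiple of [gps_dir b j], and [L] pushes
    along [b]; thus the coordinates sum to [L]. *)
Definition regulator t i : R := rho i t - b i * (\sum_j rho j t - L t).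
Definition regulated t i : R := psi t i + regulator t i.
Local Notation eta := regulator.
Local Notation phi := regulated.

Hypothesis phi_ge0 : forall t i, 0 <= t -> 0 <= phi t i.
Hypothesis rho_flat : forall s t i, 0 <= s -> s <= t ->
  (forall u, s <= u <= t -> 0 < phi u i) -> rho i t = rho i s.
Hypothesis rho_left : forall t i e, 0 < t -> 0 < phi t i -> 0 < e ->
  exists2 s, s < t & rho i t - e < rho i s.
Hypothesis L_flat : forall s t i, 0 <= s -> s <= t ->
  (forall u, s <= u <= t -> 0 < phi u i) -> L t = L s.
Hypothesis L_left : forall t i e, 0 < t -> 0 < phi t i -> 0 < e ->
  exists2 s, s < t & L t - e < L s.

Let nd (f : cumulative R R) s t : s <= t -> f s <= f t.
Proof. by move=> st; exact: cumulative_is_nondecreasing. Qed.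

Let rc (f : cumulative R R) t : f u @[u --> t^'+] --> f t.
Proof. exact: cumulative_is_right_continuous. Qed.

Let lc (f : cumulative R R) t : cvg (f u @[u --> t^'-]).
Proof. by apply: nondecreasing_left_cvg => s u; exact: nd. Qed.

Let eta_rc t i : eta u i @[u --> t^'+] --> eta t i.
Proof.
apply: cvgB; first exact: rc.
apply: cvgM; first exact: cvg_cst.
by apply: cvgB; [apply: cvg_sumr => j _; exact: rc|exact: rc].
Qed.

Let eta_cadlag : cadlag eta.
Proof.
split=> t i t0; first exact: eta_rc.
apply: is_cvgB; first exact: lc.
apply: is_cvgM; first exact: is_cvg_cst.
apply: is_cvgB; last exact: lc.
apply/cvg_ex; exists (\sum_j lim (rho j u @[u --> t^'-])).
by apply: cvg_sumr => j _; exact: lc.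
Qed.

Let phi_cadlag : cadlag phi.
Proof.
have [pr pl] := psi_cadlag; have [er el] := eta_cadlag.
split=> t i t0; first by apply: cvgD; [exact: pr|exact: er].
by apply: is_cvgD; [exact: pl|exact: el].
Qed.

Let phi_rc t i : 0 <= t -> phi u i @[u --> t^'+] --> phi t i.
Proof. by move=> t0; exact: (proj1 phi_cadlag). Qed.

Let eta_neg t i : t <= 0 -> eta t i = 0.
Proof.
move=> t0; rewrite /eta rho_neg // L_neg // big1 => [|j _]; last exact: rho_neg.
by rewrite subrr mulr0 subrr.
Qed.

Let W t := 2 * \sum_i rho i t + L t.

(** The increment of [eta_i] is at most [d rho_i + b_i D] in absolute value, with
    [D = sum_j d rho_j + dL]. As the weights sum to 1, these bounds add up to the increment of
    [W]. *)
Let eta_W s t : s <= t -> dist_eta eta s t <= W t - W s.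
Proof.
move=> st; apply: le_trans (enorm_le_sum _) _.
pose D := \sum_j (rho j t - rho j s) + (L t - L s).
apply: (@le_trans _ _ (\sum_i ((rho i t - rho i s) + b i * D))).
  apply: ler_sum => i _.
  rewrite (_ : _ - _ = rho i t - rho i s -
      b i * (\sum_j (rho j t - rho j s) - (L t - L s))); last first.
    by rewrite /eta sumrB; ring.
  have r0 : 0 <= rho i t - rho i s by rewrite subr_ge0 nd.
  have S0 : 0 <= \sum_j (rho j t - rho j s).
    by apply: sumr_ge0 => j _; rewrite subr_ge0 nd.
  have L0 : 0 <= L t - L s by rewrite subr_ge0 nd.
  apply: le_trans (ler_normB _ _) _; rewrite ger0_norm // lerD2l.
  rewrite normrM gtr0_norm // ler_pM2l // /D.
  apply: le_trans (ler_normB _ _) _; rewrite !ger0_norm //.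
rewrite big_split /= -mulr_suml b_sum1 mul1r /D /W sumrB.
by rewrite le_eqVlt; apply/predU1P; left; ring.
Qed.

Let W_rc t : W u @[u --> t^'+] --> W t.
Proof.
apply: cvgD; last exact: rc.
by apply: cvgM; [exact: cvg_cst|apply: cvg_sumr => i _; exact: rc].
Qed.

Let eta_W0 s t (_ : 0 <= s) (st : s <= t) : dist_eta eta s t <= W t - W s :=
  eta_W st.

Let V := tvar_cumulative eta_W0 (fun t _ => @W_rc t).
Local Notation mu := (lebesgue_stieltjes_measure V).

Let V_neg t : t <= 0 -> V t = 0.
Proof.
rewrite le_eqVlt => /predU1P[->|t0]; first exact: (tvar0 eta_W0).
exact: tvar_neg.
Qed.

Let eta_V s t : s <= t -> dist_eta eta s t <= V t - V s.
Proof.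
move=> st; have [s0|s0] := leP 0 s; first exact: (tvar_dist eta_W0).
have [t0|t0] := leP t 0.
  rewrite !V_neg //; last exact: ltW.
  rewrite subrr /dist_eta (_ : (fun i => _) = fun=> 0) ?enorm0 //.
  by apply/funext => i; rewrite !eta_neg ?subrr // ltW.
have H : dist_eta eta 0 t <= V t - V 0 := tvar_dist eta_W0 (lexx 0) (ltW t0).
rewrite (V_neg (ltW s0)) -[X in _ - X](V_neg (lexx 0)).
suff -> : dist_eta eta s t = dist_eta eta 0 t by [].
by congr enorm; apply/funext => i; rewrite (eta_neg _ (ltW s0)) (eta_neg _ (lexx 0)).
Qed.

Let density_exists : exists g : R -> A -> R,
  [/\ forall i, measurable_fun [set: measurableTypeR R] (g ^~ i),
      forall x i, `|g x i| <= 1 &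
      forall s t i, s <= t -> (eta t i - eta s i)%:E =
        (\int[mu]_(x in `]s, t]) (g x i)%:E)%E].
Proof.
have H i : exists g : R -> R, [/\ measurable_fun [set: measurableTypeR R] g,
    forall x, `|g x| <= 1 & forall s t, s <= t -> (eta t i - eta s i)%:E =
      (\int[mu]_(x in `]s, t]) (g x)%:E)%E].
  apply: (@exists_density R V (fun t => eta t i)) => s t st.
  apply: le_trans (norm_le_enorm (fun k => eta t k - eta s k) i) _; exact: eta_V.
have [g gP] := choice H.
by exists (fun x i => g i x); split => [i|x i|s t i]; have [] := gP i; auto.
Qed.

(** * The density of the regulator as a field of unit directions in the cones *)

Section WithDensity.
Variable g : R -> A -> R.
Hypothesis mg : forall i, measurable_fun [set: measurableTypeR R] (g ^~ i).
Hypothesis g1 : forall x i, `|g x i| <= 1.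
Hypothesis etaE : forall s t i, s <= t -> (eta t i - eta s i)%:E =
  (\int[mu]_(x in `]s, t]) (g x i)%:E)%E.

Let nd0 : nondecreasing (fun _ : R => 0 : R). Proof. by []. Qed.
Let rc0 : right_continuous (fun _ : R => 0 : R).
Proof. by move=> t; exact: cvg_cst. Qed.
Let zeroC := cumul_of nd0 rc0.

Let LS_zero (E : set (measurableTypeR R)) : measurable E ->
  lebesgue_stieltjes_measure zeroC E = 0%E.
Proof.
move=> mE; rewrite (LS_unique (mu := mzero)) // => a c ac.
by rewrite /= subrr.
Qed.

Let LS_scale (c : {nonneg R}) (q : cumulative R R) (E : set (measurableTypeR R)) :
  measurable E -> lebesgue_stieltjes_measure q E = 0%E ->
  lebesgue_stieltjes_measure (cumulZ c q) E = 0%E.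
Proof.
move=> mE qE; rewrite (LS_unique (mu := mscale c (lebesgue_stieltjes_measure q))) //.
  suff : (c%:num%:E * lebesgue_stieltjes_measure q E = 0)%E by [].
  by rewrite qE mule0.
move=> a d ad.
suff : (c%:num%:E * lebesgue_stieltjes_measure q `]a, d]%classic =
    (cumulZ c q d - cumulZ c q a)%:E)%E by [].
by rewrite LS_oc // -EFinM mulrBr.
Qed.

Let E j := possupp (phi ^~ j).
Let mE j : measurable (E j : set (measurableTypeR R)).
Proof. by apply: measurable_possupp => t t0; exact: phi_rc. Qed.

Let rho_E j : lebesgue_stieltjes_measure (rho j) (E j) = 0%E.
Proof.
apply: possupp_null.
- by move=> t; exact: rho_neg.
- by move=> t t0; exact: phi_rc.
- by move=> s t s0 st; exact: rho_flat.
- by move=> t e; exact: rho_left.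
Qed.

Let L_E j : lebesgue_stieltjes_measure L (E j) = 0%E.
Proof.
apply: possupp_null.
- exact: L_neg.
- by move=> t t0; exact: phi_rc.
- by move=> s t s0 st; exact: L_flat.
- by move=> t e; exact: L_left.
Qed.

Let sum_eta t : \sum_i eta t i = L t.
Proof. by rewrite /eta sumrB -mulr_suml b_sum1 mul1r opprB addrC subrK. Qed.

Let etaw w s t : s <= t ->
  (dotp w (eta t) - dotp w (eta s))%:E =
    (\int[mu]_(x in `]s, t]) (dotp w (g x))%:E)%E.
Proof.
move=> st; rewrite -dotpBr.
by apply: (dotp_density w mg g1) => i; exact: etaE.
Qed.

Let gw w x : `|dotp w (g x)| <= \sum_i `|w i|.
Proof. by rewrite -[leRHS]mulr1; exact: norm_dotp_le. Qed.

Let mgw w : measurable_fun [set: measurableTypeR R] (fun x => dotp w (g x)).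
Proof. exact: measurable_dotp. Qed.

Let dotp_cst (c : R) (x : A -> R) : dotp (fun _ => c) x = c * \sum_i x i.
Proof. by rewrite /dotp mulr_sumr. Qed.

(** The sum of the coordinates of the density is a density of the nondecreasing function [L]. *)
Let sum_ge0 : {ae mu, forall x : R, 0 <= \sum_i g x i}.
Proof.
have := @density_ge0 _ V L zeroC (fun t => dotp (fun=> 1) (eta t))
  (fun x => dotp (fun=> 1) (g x)) _ setT measurableT (mgw _) (gw _) (etaw _).
move=> H; apply: ae_LSS (H _ _).
- by move=> x /(_ I); rewrite dotp_cst mul1r.
- by move=> s t st; rewrite !dotp_cst !mul1r !sum_eta /= subrr addr0.
- exact: LS_zero.
Qed.

Let sum_le0 j : {ae mu, forall x : R, E j x -> \sum_i g x i <= 0}.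
Proof.
have := @density_ge0 _ V zeroC L (fun t => dotp (fun=> -1) (eta t))
  (fun x => dotp (fun=> -1) (g x)) _ (E j) (mE j) (mgw _) (gw _) (etaw _).
move=> H; apply: ae_LSS (H _ (L_E j)).
- by move=> x Hx /Hx; rewrite dotp_cst mulN1r oppr_ge0.
- by move=> s t st; rewrite !dotp_cst !sum_eta /= subrr; ring.
Qed.

Let dotp_delta (i : A) (x : A -> R) : dotp (fun k => (k == i)%:R) x = x i.
Proof.
rewrite /dotp (bigD1 i) //= eqxx mul1r big1 ?addr0 // => k ki.
by rewrite (negbTE ki) mul0r.
Qed.

(** In [b_j eta_i - b_i eta_j] the common push along [b] cancels and [b_j rho_i - b_i rho_j]
    remains, where [rho_j] does not charge [E j]. *)
Let cross_ge0 j i : {ae mu, forall x : R, E j x -> 0 <= b j * g x i - b i * g x j}.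
Proof.
pose w k : R := b j * (k == i)%:R - b i * (k == j)%:R.
have wE x : dotp w x = b j * x i - b i * x j.
  rewrite -(dotp_delta i x) -(dotp_delta j x) /dotp !mulr_sumr -sumrB.
  by apply: eq_bigr => k _; rewrite /w; ring.
pose cj := NngNum (ltW (b_gt0 j)); pose ci := NngNum (ltW (b_gt0 i)).
have := @density_ge0 _ V (cumulZ cj (rho i)) (cumulZ ci (rho j))
  (fun t => dotp w (eta t)) (fun x => dotp w (g x)) _ (E j) (mE j) (mgw _) (gw _) (etaw _).
move=> H; apply: ae_LSS (H _ (LS_scale _ (mE j) (rho_E j))).
- by move=> x Hx /Hx; rewrite wE.
- by move=> s t st; rewrite !wE /= /eta; ring.
Qed.

Let gnorm_le w : {ae mu, forall x : R, dotp w (g x) <= enorm w}.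
Proof.
pose f t := enorm w * V t - dotp w (eta t).
have fnd : nondecreasing f.
  move=> s t st; rewrite /f; have : dotp w (eta t) - dotp w (eta s) <=
      enorm w * (V t - V s).
    rewrite -dotpBr; apply: le_trans (dotp_le_enorm _ _) _.
    by apply: ler_wpM2l; [exact: enorm_ge0|exact: eta_V].
  by lra.
have frc : right_continuous f.
  move=> t; apply: cvgB.
    by apply: cvgM; [exact: cvg_cst|exact: rc].
  by apply: dotp_cvg => i; exact: eta_rc.
pose C := enorm w + \sum_i `|w i|.
have S0 : 0 <= \sum_i `|w i| by apply: sumr_ge0.
have wC x : `|enorm w - dotp w (g x)| <= C.
  apply: le_trans (ler_normB _ _) _; rewrite ger0_norm ?enorm_ge0 //.
  by rewrite lerD2l.
have mC : measurable_fun [set: measurableTypeR R] (fun x => enorm w - dotp w (g x)).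
  by apply: measurable_funB => //; exact: mgw.
have fE s t : s <= t -> (f t - f s)%:E =
    (\int[mu]_(x in `]s, t]) (enorm w - dotp w (g x))%:E)%E.
  move=> st.
  have c1 (x : R) : `|cst (enorm w) x| <= C by rewrite ger0_norm ?enorm_ge0 // lerDl.
  have c2 x : `|dotp w (g x)| <= C by apply: le_trans (gw w x) _; rewrite lerDr enorm_ge0.
  rewrite (@integralB_oc _ V (cst (enorm w)) _ C _ _ _ c1 (mgw w) c2) //.
  by rewrite integral_cst_oc // -etaw // -EFinB /f; congr EFin; lra.
have := @density_ge0 _ V (cumul_of fnd frc) zeroC f
  (fun x => enorm w - dotp w (g x)) C setT measurableT mC wC fE.
move=> H; apply: ae_LSS (H _ _).
- by move=> x /(_ I); rewrite subr_ge0.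
- by move=> s t st; rewrite /= subrr addr0.
- exact: LS_zero.
Qed.
Let rat_dense (y : A -> R) (e : R) : 0 < e ->
  exists r : {ffun A -> rat}, enorm (fun i => ratr (r i) - y i) <= e.
Proof.
move=> e0; pose d := e / (#|A|%:R + 1).
have n0 : 0 < #|A|%:R + 1 :> R by rewrite ltr_wpDl.
have d0 : 0 < d by rewrite divr_gt0.
have /choice[r rP] : forall i, exists r : rat, y i < ratr r < y i + d.
  move=> i; have [|r] := @rat_in_itvoo R (y i) (y i + d); first by rewrite ltrDl.
  by rewrite in_itv /=; exists r.
exists [ffun i => r i]; apply: le_trans (enorm_le_sum _) _.
apply: (@le_trans _ _ (\sum_(i : A) d)).
  apply: ler_sum => i _; rewrite ffunE; have /andP[r1 r2] := rP i.
  by rewrite ger0_norm; [rewrite lerBlDl ltW|rewrite subr_ge0 ltW].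
rewrite sumr_const -mulr_natr /d mulrAC ler_pdivrMr //.
by rewrite ler_pM2l // lerDl.
Qed.

(** The norm is a supremum over test vectors; a common null set allows only countably many, and
    rational vectors close to [g x] suffice. *)
Let gnorm_le1 : {ae mu, forall x : R, enorm (g x) <= 1}.
Proof.
have H : {ae mu, forall x : R, forall r : {ffun A -> rat},
    dotp (fun i => ratr (r i)) (g x) <= enorm (fun i => ratr (r i) : R)}.
  by apply: ae_LS_forall => r; exact: gnorm_le.
apply: ae_LSS H => x H; rewrite leNgt; apply/negP => y1.
set y := enorm (g x) in y1.
(* A rational vector within [e] of [g x] yields [y^2 - e y <= e + y], that is
   [y (y - 1) <= e (y + 1)]; for this [e] the right-hand side is half of the left-hand one. *)
pose e := y * (y - 1) / (2 * (y + 1)).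
have e0 : 0 < e by rewrite divr_gt0 ?mulr_gt0 //; lra.
have [r re] := rat_dense (g x) e0.
have := H r; pose z i : R := ratr (r i) - g x i.
have rz : (fun i => ratr (r i)) = (fun i => z i + g x i).
  by apply/funext => i; rewrite /z subrK.
have z1 : enorm (fun i => ratr (r i) : R) <= e + y.
  by rewrite rz; apply: le_trans (enormD _ _) _; rewrite lerD2r.
have z2 : dotp (fun i => ratr (r i)) (g x) = dotp z (g x) + y ^+ 2.
  rewrite /y enorm_sqr /dotp -big_split /=; apply: eq_bigr => i _.
  by rewrite /z; ring.
have z3 : - (e * y) <= dotp z (g x).
  rewrite lerNl -dotpNl; apply: le_trans (dotp_le_enorm _ _) _.
  have -> : enorm (fun i => - z i) = enorm z.
    by rewrite /enorm; congr Num.sqrt; apply: eq_bigr => i _; rewrite sqrrN.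
  by rewrite ler_wpM2r ?enorm_ge0.
rewrite z2 => z4.
have : e * (y + 1) = y * (y - 1) / 2.
  by rewrite /e; field; lra.
have : y * (y - 1) > 0 by rewrite mulr_gt0 //; lra.
nra.
Qed.

Let mnorm : measurable_fun [set: measurableTypeR R] (fun x => enorm (g x)).
Proof.
apply: (measurableT_comp (continuous_measurable_fun (@sqrt_continuous R))).
by apply: measurable_sum => i; exact: measurable_funX.
Qed.

Let norm_bound x : `|enorm (g x)| <= #|A|%:R.
Proof.
rewrite ger0_norm ?enorm_ge0 //; apply: le_trans (enorm_le_sum _) _.
apply: le_trans (_ : \sum_(i : A) 1 <= _); last by rewrite sumr_const.
by apply: ler_sum => i _; exact: g1.
Qed.

Let intnorm s t : (\int[mu]_(x in `]s, t]) (enorm (g x))%:E)%E \is a fin_num.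
Proof. exact: integrable_fin_num (bounded_integrable_oc _ _ _ mnorm norm_bound). Qed.

(** The increment is tested against itself, Cauchy-Schwarz is applied under the integral, and its
    norm is divided out. *)
Let dist_le_intnorm s t : s <= t ->
  ((dist_eta eta s t)%:E <= \int[mu]_(x in `]s, t]) (enorm (g x))%:E)%E.
Proof.
move=> st; set I := (X in (_ <= X)%E).
have I0 : (0 <= I)%E by apply: integral_ge0 => x _; rewrite lee_fin enorm_ge0.
have [D0|D0] := eqVneq (dist_eta eta s t) 0; first by rewrite D0.
have Dpos : 0 < dist_eta eta s t by rewrite lt_def D0 dist_eta_ge0.
pose w i := eta t i - eta s i.
have : ((dist_eta eta s t ^+ 2)%:E <= (dist_eta eta s t)%:E * I)%E.
  rewrite /I -ge0_integralZl_EFin //; last 3 first.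
  - by move=> x _; rewrite lee_fin enorm_ge0.
  - exact/measurable_funTS/measurable_EFinP.
  - exact: ltW.
  have -> : (dist_eta eta s t ^+ 2)%:E = (dotp w (eta t) - dotp w (eta s))%:E.
    by rewrite /dist_eta enorm_sqr -dotpBr.
  rewrite etaw //.
  pose C := dist_eta eta s t * #|A|%:R + \sum_i `|w i|.
  have S0 : 0 <= \sum_i `|w i| by apply: sumr_ge0.
  have m2 : measurable_fun [set: measurableTypeR R]
      (fun x => dist_eta eta s t * enorm (g x)) by exact: measurable_funM.
  apply: (@ae_le_integral_oc _ V _ (fun x => dist_eta eta s t * enorm (g x)) C) => //.
  - by move=> x; apply: le_trans (gw w x) _; rewrite lerDr mulr_ge0 // ltW.
  - move=> x; rewrite normrM (ger0_norm (ltW Dpos)).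
    apply: le_trans (_ : dist_eta eta s t * #|A|%:R <= _); last by rewrite lerDl.
    by rewrite ler_pM2l.
  - by apply: aeW => x _; exact: dotp_le_enorm.
have If : I \is a fin_num by exact: intnorm.
by rewrite -(fineK If) -EFinM !lee_fin expr2 ler_pM2l.
Qed.

Let int_norm_le s t : s <= t ->
  (\int[mu]_(x in `]s, t]) (enorm (g x))%:E <= (V t - V s)%:E)%E.
Proof.
move=> st; rewrite -[X in (_ <= (X)%:E)%E]mul1r -integral_cst_oc //.
apply: (@ae_le_integral_oc _ V _ (cst 1) (#|A|%:R + 1)) => //.
- by move=> x; apply: le_trans (norm_bound x) _; rewrite lerDl.
- by move=> x; rewrite normr1 lerDr.
- by apply: ae_LSS gnorm_le1.
Qed.

Let int_norm_split s u t : s <= u -> u <= t ->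
  (\int[mu]_(x in `]s, t]) (enorm (g x))%:E =
   \int[mu]_(x in `]s, u]) (enorm (g x))%:E +
   \int[mu]_(x in `]u, t]) (enorm (g x))%:E)%E.
Proof.
move=> su ut.
rewrite (_ : `]s, t]%classic = `]s, u]%classic `|` `]u, t]%classic); last first.
  by rewrite -itv_bndbnd_setU // bnd_simp.
rewrite ge0_integral_setU //.
- exact/measurable_funTS/measurable_EFinP.
- by move=> x _; rewrite lee_fin enorm_ge0.
- apply/disj_setPS => x; rewrite /= !in_itv /= => -[/andP[_ xs] /andP[sx _]].
  by have := le_lt_trans xs sx; rewrite ltxx.
Qed.

(* The total variation of [eta] on [0, t] is at most the integral of [|g|]; since
   [|g| <= 1] gives the reverse inequality on [0, s], the bound passes to
   increments. *)
Let int_norm_ge s t : s <= t ->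
  ((V t - V s)%:E <= \int[mu]_(x in `]s, t]) (enorm (g x))%:E)%E.
Proof.
move=> st; have [t0|t0] := leP t 0.
  rewrite !V_neg ?(le_trans st) // subrr; apply: integral_ge0 => x _.
  by rewrite lee_fin enorm_ge0.
pose I u := (\int[mu]_(x in `]0%R, u]) (enorm (g x))%:E)%E.
pose w u := fine (I u).
have wE u : (w u)%:E = I u by rewrite fineK //; exact: intnorm.
have wD u r : 0 <= u -> u <= r ->
    (w r - w u)%:E = (\int[mu]_(x in `]u, r]) (enorm (g x))%:E)%E.
  move=> u0 ur; rewrite EFinB !wE /I (int_norm_split u0 ur).
  by rewrite [X in (X - _)%E]addeC addeK //; exact: intnorm.
have Vw : V t <= w t.
  have : V t <= w t - w 0.
    apply: (tvar_le eta_W0) => [u r u0 ur|]; last exact: ltW.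
    by rewrite -lee_fin wD // dist_le_intnorm.
  suff -> : w 0 = 0 by rewrite subr0.
  by rewrite /w /I set_itv_ge ?integral_set0 // bnd_simp ltxx.
have [s0|s0] := leP 0 s.
  rewrite -wD // lee_fin lerB //.
  by have := int_norm_le s0; rewrite -/(I s) -wE lee_fin (V_neg (lexx 0)) subr0.
rewrite (V_neg (ltW s0)) subr0 (int_norm_split (ltW s0) (ltW t0)).
rewrite -/(I t) -wE; apply: le_trans (_ : (w t)%:E <= _)%E; first by rewrite lee_fin.
by rewrite leeDr // integral_ge0 // => x _; rewrite lee_fin enorm_ge0.
Qed.

Let gnorm_ge1 : {ae mu, forall x : R, 1 <= enorm (g x)}.
Proof.
pose C : R := #|A|%:R + 1.
have mC : measurable_fun [set: measurableTypeR R] (fun x => enorm (g x) - 1).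
  exact: measurable_funB.
have boundC x : `|enorm (g x) - 1| <= C.
  by apply: le_trans (ler_normB _ _) _; rewrite normr1 lerD2r.
have fE s t : s <= t -> ((fun=> 0) t - (fun=> 0) s : R)%:E =
    (\int[mu]_(x in `]s, t]) (enorm (g x) - 1)%:E)%E.
  move=> st.
  have c1 x : `|enorm (g x)| <= C by apply: le_trans (norm_bound x) _; rewrite lerDl.
  have c2 (x : R) : `|cst 1 x : R| <= C by rewrite normr1 lerDr.
  rewrite (@integralB_oc _ V _ (cst 1) C _ _ mnorm c1 _ c2) //.
  rewrite integral_cst_oc // mul1r.
  suff -> : (\int[mu]_(x in `]s, t]) (enorm (g x))%:E = (V t - V s)%:E)%E.
    by rewrite -EFinB !subrr.
  by apply/eqP; rewrite eq_le int_norm_ge // int_norm_le.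
have := @density_ge0 _ V zeroC zeroC (fun=> 0) (fun x => enorm (g x) - 1) C setT
  measurableT mC boundC fE.
move=> H; apply: ae_LSS (H _ _).
- by move=> x /(_ I); rewrite subr_ge0.
- by move=> s t st; rewrite /= subrr addr0.
- exact: LS_zero.
Qed.
Let mu_0 : mu [set 0] = 0%E.
Proof.
apply/eqP; rewrite -measure_le0.
apply: (@le_trans _ _ (mu `]-1, 0]%classic)).
  apply: le_measure; rewrite ?inE; [exact: measurable_set1|exact: measurable_itv|].
  by move=> _ ->; rewrite /= in_itv /= lexx ltrN10.
by rewrite [leLHS](LS_oc V) ?lerN10 // !V_neg ?lerN10 // subrr.
Qed.

Let integral_c0 (f : R -> R) t : 0 <= t ->
  measurable_fun [set: measurableTypeR R] f ->
  (\int[mu]_(x in `[0%R, t]) (f x)%:E = \int[mu]_(x in `]0%R, t]) (f x)%:E)%E.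
Proof.
move=> t0 mf; rewrite (_ : `[0, t]%classic = [set 0] `|` `]0, t]%classic); last first.
  by rewrite setU1itv // bnd_simp.
have m0 : measurable ([set 0] : set (measurableTypeR R)) by exact: measurable_set1.
rewrite integral_setU //; last 2 first.
- exact/measurable_funTS/measurable_EFinP.
- by apply/disj_setPS => x [->] /=; rewrite in_itv /= ltxx.
rewrite [X in (X + _)%E](_ : _ = 0%E) ?add0e //.
rewrite -[RHS](@integral0 _ _ _ mu [set 0]).
apply: ae_eq_integral => //; first exact/measurable_funTS/measurable_EFinP.
by apply: ae_eq0 => //; exact: mu_0.
Qed.

Let cone_ae : {ae mu, forall x : R, 0 <= x ->
  gps_cone b (phi x) (g x) /\ enorm (g x) = 1}.
Proof.
have H1 : {ae mu, forall x : R, 0 <= \sum_i g x i /\ enorm (g x) = 1}.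
  apply: ae_LSS (ae_LSI sum_ge0 (ae_LSI gnorm_le1 gnorm_ge1)) => x [? [a1 a2]].
  by split=> //; apply/eqP; rewrite eq_le a1 a2.
have H2 : {ae mu, forall x : R, forall j, E j x -> \sum_i g x i <= 0}.
  by apply: ae_LS_forall => j; exact: sum_le0.
have H3 : {ae mu, forall x : R, forall ji : A * A,
    E ji.1 x -> 0 <= b ji.1 * g x ji.2 - b ji.2 * g x ji.1}.
  by apply: ae_LS_forall => ji; exact: cross_ge0.
apply: ae_LSS (ae_LSI H1 (ae_LSI H2 H3)) => x [[S0 gn] [Sle cross]] x0.
split=> //; apply: gps_coneI => // [i|j xj]; first exact: phi_ge0.
have Ej : E j x by [].
by split=> [|i]; [exact: Sle Ej|exact: (cross (j, i))].
Qed.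

Lemma gps_SP_of_density : gps_SP b psi phi eta.
Proof.
split=> //.
- by move=> i; rewrite /phi eta_neg ?addr0.
- by move=> t t0; split=> [i //|i]; exact: phi_ge0.
exists V; split.
- by move=> t t0; apply: V_neg; exact: ltW.
- by move=> t t0; exact: (vec_total_variation_tvar eta_W0 t0).
(* [B] is a measurable set that agrees with the boundary times on the nonnegative half-line. *)
- move=> t t0; pose B : set (measurableTypeR R) := ~` \bigcap_(j in [set: A]) E j.
  have mB : measurable B.
    by apply: measurableC; apply: fin_bigcap_measurable => // j _; exact: mE.
  have BE s : 0 <= s -> orthant_boundary (phi s) <-> B s.
    move=> s0; have phis : orthant (phi s) by move=> i; exact: phi_ge0.
    rewrite (orthant_boundaryP phis); split=> [[i si] /(_ i I)[_]|nB].
      by rewrite si ltxx.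
    apply: contrapT => /forallNP H; apply: nB => j _; split=> //.
    by rewrite lt_def phi_ge0 // andbT; exact/eqP/H.
  rewrite (eq_integral (fun x : measurableTypeR R => (\1_B x)%:E)); last first.
    move=> x; rewrite inE /= in_itv /= => /andP[x0 _]; congr EFin.
    by rewrite !indicE; congr (_%:R); congr nat_of_bool; apply: asbool_equiv_eq; exact: BE.
  have m1 : measurable_fun [set: measurableTypeR R] (\1_B : _ -> R).
    exact: measurable_indic.
  rewrite integral_c0 //.
  transitivity (\int[mu]_(x in `]0%R, t]) (1 : R)%:E)%E.
    by rewrite integral_cst_oc // mul1r (V_neg (lexx 0)) subr0.
  apply: ae_eq_integral => //; first exact/measurable_funTS/measurable_EFinP.
  apply: ae_LSS cone_ae => x H; rewrite /= in_itv /= => /andP[/ltW x0 _].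
  have [[a [a0 [_ _ a0E gE]]] gn] := H x0.
  (* Off [B] all coordinates are positive and the cone is zero, against [enorm (g x) = 1]. *)
  rewrite indicE mem_set // => BE0.
  suff g0 : g x = fun=> 0 by move: gn; rewrite g0 enorm0 => /eqP; rewrite eq_sym oner_eq0.
  apply/funext => j; rewrite gE a0E ?mul0r ?addr0.
    rewrite big1 // => i /eqP xi; have [_] := BE0 i I.
    by rewrite xi ltxx.
  by exists j; have [_ /gt_eqF ->] := BE0 j I.
- exists g; split => //.
  + by move=> i; apply: measurable_funTS; exact: mg.
  + move=> t i t0; rewrite integral_c0 // -etaE //.
    by rewrite (eta_neg _ (lexx 0)) subr0.
Qed.
End WithDensity.

Lemma gps_SP_of_regulators : gps_SP b psi phi eta.
Proof.
by have [g [mg g1 etaE]] := density_exists; exact: gps_SP_of_density mg g1 etaE.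
Qed.
End SkorokhodFromRegulators.

Section SkorokhodExistence.
Context {R : realType} {A : finType}.
Variables (b : A -> R) (psi m : R -> A -> R) (M L : R -> R).
Hypothesis b_gt0 : forall i, 0 < b i.
Hypothesis b_sum1 : \sum_i b i = 1.
Hypothesis psi_cadlag : cadlag psi.
Hypothesis m_nd : forall s t i, 0 <= s -> s <= t -> m s i <= m t i.
Hypothesis m_0 : forall i, m 0 i = 0.
Hypothesis M_0 : M 0 = 0.
Hypothesis M_rc : forall t, 0 <= t -> M u @[u --> t^'+] --> M t.
Hypothesis L_nd : forall s t, 0 <= s -> s <= t -> L s <= L t.
Hypothesis L_rc : forall t, 0 <= t -> L u @[u --> t^'+] --> L t.
Hypothesis LE : forall t, 0 <= t -> L t = \sum_i m t i - M t.
Hypothesis mM_ge0 : forall t i, 0 <= t -> 0 <= psi t i - b i * M t + m t i.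
Hypothesis L_flat : forall s t, 0 <= s -> s <= t ->
  (forall u, s <= u <= t -> 0 < \sum_i psi u i + L u) -> L t = L s.
Hypothesis L_left : forall t e, 0 < t -> 0 < \sum_i psi t i + L t -> 0 < e ->
  exists2 s, 0 <= s < t & L t - e < L s.

Let psi_rc t i : 0 <= t -> psi u i @[u --> t^'+] --> psi t i.
Proof. exact: (proj1 psi_cadlag). Qed.

Let X := gfix b psi M L.
Let rho i t := reg b psi X t i.

Let rho_nd i : nondecreasing (rho i).
Proof.
move=> s t st; apply: (reg_nd b_gt0 m_nd m_0 mM_ge0) => // u u0.
exact: (gfix_le b_gt0 m_nd m_0 LE mM_ge0).
Qed.

Let rho_neg i t : t <= 0 -> rho i t = 0.
Proof. exact: (reg_neg b_gt0 m_nd m_0 LE mM_ge0). Qed.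

Let rho_rc i : right_continuous (rho i).
Proof.
move=> t; have [t0|t0] := leP 0 t.
  exact: (reg_gfix_rc b_gt0 psi_rc m_nd m_0 M_rc L_rc LE mM_ge0).
rewrite (rho_neg i (ltW t0)); apply: cvg_near_cst; near=> u.
by apply: rho_neg; near: u; exact: nbhs_right_ltW.
Unshelve. all: by end_near. Qed.

Let L0 : L 0 = 0.
Proof. by rewrite LE // M_0 subr0 big1. Qed.

Let Lc t := L (Num.max 0 t).

Let Lc_nd : nondecreasing Lc.
Proof.
move=> s t st; apply: L_nd; first by rewrite le_max lexx.
by rewrite ge_max !le_max lexx st orbT.
Qed.

Let LcE t : 0 <= t -> Lc t = L t.
Proof. by move=> t0; rewrite /Lc; congr L; apply/max_idPr. Qed.

Let Lc_neg t : t <= 0 -> Lc t = 0.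
Proof. by move=> t0; rewrite /Lc (max_idPl t0). Qed.

Let Lc_rc : right_continuous Lc.
Proof.
move=> t; have [t0|t0] := leP 0 t; last first.
  rewrite (Lc_neg (ltW t0)); apply: cvg_near_cst; near=> u.
  by apply: Lc_neg; near: u; exact: nbhs_right_ltW.
rewrite (LcE t0); apply: cvg_trans (L_rc t0); apply: near_eq_cvg.
near=> u; rewrite LcE //; apply: le_trans t0 _; apply: ltW.
by near: u; exact: nbhs_right_gt.
Unshelve. all: by end_near. Qed.

Let rhoC i := cumul_of (@rho_nd i) (@rho_rc i).
Let LC := cumul_of Lc_nd Lc_rc.

Let regulatedE t i : 0 <= t -> regulated b psi rhoC LC t i =
  psi t i - b i * X t + reg b psi X t i.
Proof.
move=> t0; rewrite /regulated /regulator /= LcE //.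
by rewrite /X (gfixE b_gt0 m_nd m_0 LE mM_ge0 t0) -/X /rho; ring.
Qed.

(** The regulators cancel in the sum, so the times at which [L] may grow are known before the fixed
    point is. *)
Let sum_regulated t : 0 <= t ->
  \sum_i regulated b psi rhoC LC t i = \sum_i psi t i + L t.
Proof.
move=> t0; rewrite /regulated big_split /=; congr (_ + _).
by rewrite /regulator sumrB -mulr_suml b_sum1 mul1r opprB addrC subrK /= LcE.
Qed.

Lemma gps_SM_exists : exists phi, gps_SM b psi phi.
Proof.
have phi0 t i : 0 <= t -> 0 <= regulated b psi rhoC LC t i.
  move=> t0; rewrite regulatedE //.
  exact: (gfix_path_ge0 b_gt0 m_nd m_0 LE mM_ge0).
have phipos t i : 0 <= t -> 0 < regulated b psi rhoC LC t i ->
    0 < \sum_i psi t i + L t.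
  move=> t0 ti; rewrite -sum_regulated // (bigD1 i) //= ltr_pwDl //.
  by apply: sumr_ge0 => j _; exact: phi0.
exists (regulated b psi rhoC LC), (regulator b rhoC LC).
apply: gps_SP_of_regulators => //.
- by move=> t i; exact: rho_neg.
- move=> s t i s0 st H.
  apply: (reg_flat b_gt0 psi_rc m_nd m_0 M_rc L_rc LE mM_ge0) => // u sut.
  have /andP[su _] := sut.
  by rewrite -regulatedE ?(le_trans s0) // H.
- move=> t i e t0; rewrite regulatedE ?ltW // => ti e0.
  have [s /andP[_ st] H] := reg_left b_gt0 m_nd m_0 LE mM_ge0 t0 ti e0.
  by exists s.
- move=> s t i s0 st H; rewrite /= !LcE ?(le_trans s0) //.
  apply: L_flat => // u sut; have /andP[su _] := sut.
  by apply: (phipos _ i); [exact: le_trans su|exact: H].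
- move=> t i e t0 ti e0.
  have [s /andP[s0 st] H] := L_left t0 (phipos _ _ (ltW t0) ti) e0.
  by exists s => //=; rewrite !LcE // ltW.
Qed.
End SkorokhodExistence.

(** * The reduced problem *)

Lemma total_variation_dist {R : realType} {A : finType} (eta : R -> A -> R)
    (v : R -> R) (s t : R) :
  (forall u, 0 <= u -> vec_total_variation eta u = (v u)%:E) ->
  0 <= s -> s <= t -> dist_eta eta s t <= v t - v s.
Proof.
move=> vE s0; rewrite le_eqVlt => /predU1P[<-|st].
  by rewrite dist_etaxx subrr.
have t0 : 0 <= t by exact: ltW (le_lt_trans s0 st).
suff : v s <= v t - dist_eta eta s t by lra.
rewrite -lee_fin -vE //; apply: ge_ereal_sup => _ [l [pl /eqP ls] <-].
rewrite lee_fin lerBrDr vec_variation_pvar -ls -pvar_rcons -lee_fin -vE //.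
apply: ereal_sup_ubound; exists (rcons l t); last by rewrite vec_variation_pvar.
by split; rewrite ?last_rcons // rcons_path pl ls.
Qed.

Lemma cadlag_restart {R : realType} {A : finType} (T0 : R) (x : A -> R)
    (psi : R -> A -> R) : 0 <= T0 -> cadlag psi -> cadlag (restart T0 x psi).
Proof.
move=> T00 cpsi.
have [Hr Hl] := cadlagB_cst (fun i => psi T0 i - x i) (cadlag_shift T00 cpsi).
have E : restart T0 x psi = fun u i => psi (T0 + u) i - (psi T0 i - x i).
  by apply/funext => u; apply/funext => i; rewrite /restart; ring.
by rewrite E; split.
Qed.

Section ReducedExistence.
Context {R : realType} {J : nat}.
Variables (beta : 'I_J -> R) (S : {set 'I_J}).
Hypothesis beta_gt0 : forall i, 0 < beta i.
Hypothesis beta_sum1 : \sum_i beta i = 1.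
Hypothesis S_proper : S \proper [set: 'I_J]%SET.
Variables (psi phi eta : R -> 'I_J -> R) (T0 : R).
Hypothesis psi_cadlag : cadlag psi.
Hypothesis T0_ge0 : 0 <= T0.
Hypothesis SP : gps_SP beta psi phi eta.
Hypothesis phiS0 : forall j, j \in S -> phi T0 j = 0.

Let bK := weightK S beta.
Let Psi := restart T0 (restrictK S phi T0) (pathK S beta psi).
Let eta0 t j := eta (T0 + t) j - eta T0 j.
Let L t := \sum_j eta0 t j.

Let phiE t i : 0 <= t -> phi t i = psi t i + eta t i.
Proof. by have [_ _ _ H _] := SP => /H[]. Qed.

Let phi_ge0 t i : 0 <= t -> 0 <= phi t i.
Proof. by have [_ _ _ H _] := SP => /H[_]; exact. Qed.

Let eta_cadlag : cadlag eta.
Proof. by have [] := SP. Qed.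

Let push T : gps_pushes beta T phi eta := gps_SP_pushes beta_gt0 beta_sum1 T SP.

Let D_sum : \sum_(k in ~: S) beta k = 1 - \sum_(j in S) beta j.
Proof.
rewrite -beta_sum1 [X in _ = X - _](bigID [in S]) /= addrAC subrr add0r.
by apply: eq_bigl => k; rewrite finset.in_setC.
Qed.

Let beta_bK (i : rest S) : beta (val i) = bK i * (1 - \sum_(j in S) beta j).
Proof.
rewrite /bK /weightK D_sum divfK // -D_sum gt_eqF //.
exact: weight_rest_gt0.
Qed.

Let dotp_const (c : R) (x : 'I_J -> R) : dotp (fun=> c) x = c * \sum_i x i.
Proof. by rewrite /dotp mulr_sumr. Qed.

(** A constant is its own average. Hence [-1] is polar at every state, which makes [L]
    nondecreasing, and [1] is polar away from the origin, which makes [L] constant there. *)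
Let polarN1 x : polar_dir beta (fun=> -1) x.
Proof.
split=> [i _|_ i]; last by rewrite oppr_le0.
by rewrite /dotp -mulr_suml beta_sum1 mul1r.
Qed.

Let polar1 x : 0 < \sum_j x j -> polar_dir beta (fun=> 1) x.
Proof.
move=> Sx; split=> [i _|x0].
  by rewrite /dotp -mulr_suml beta_sum1 mul1r.
by rewrite big1 ?ltxx // in Sx.
Qed.

Let L_diff s t : L t - L s = \sum_j (eta (T0 + t) j - eta (T0 + s) j).
Proof. by rewrite /L -sumrB; apply: eq_bigr => j _; rewrite /eta0; ring. Qed.

Let L_nd s t : 0 <= s -> s <= t -> L s <= L t.
Proof.
move=> s0; rewrite le_eqVlt => /predU1P[->//|st].
have [p _] := push (T0 + t + 1).
have := p (fun=> -1) (T0 + s) (T0 + t); rewrite addr_ge0 // ltrD2l st ltrDl ltr01.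
move=> /(_ isT isT isT (fun u _ => polarN1 (phi u))).
by rewrite dotp_const mulN1r oppr_le0 -L_diff subr_ge0.
Qed.

(** The weights [bK] sum to 1, so [pathK] preserves the sum of coordinates. That [phi] vanishes on
    [S] at [T0] alone is enough, so the identity persists when [phi] leaves 0 on [S]. *)
Let sum_phi t : 0 <= t -> \sum_i Psi t i + L t = \sum_j phi (T0 + t) j.
Proof.
move=> t0; rewrite [RHS](sum_restC S) /L (sum_restC S (eta0 t)).
rewrite /Psi /restart /pathK /restrictK.
have E (i : rest S) : phi T0 (val i) + (psi (T0 + t) (val i) +
    bK i * \sum_(j in S) psi (T0 + t) j -
    (psi T0 (val i) + bK i * \sum_(j in S) psi T0 j)) =
  (phi (T0 + t) (val i) - eta0 t (val i)) +
     bK i * \sum_(j in S) (psi (T0 + t) j - psi T0 j).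
  by rewrite /eta0 !phiE ?addr_ge0 // sumrB; ring.
under eq_bigr do rewrite E.
rewrite big_split /= -mulr_suml (weightK_sum1 beta_gt0 S_proper) mul1r sumrB.
have -> : \sum_(j in S) phi (T0 + t) j =
    \sum_(j in S) (psi (T0 + t) j - psi T0 j) + \sum_(j in S) eta0 t j.
  rewrite -big_split /=; apply: eq_bigr => j jS.
  have := phiS0 jS; rewrite !phiE ?addr_ge0 // /eta0; lra.
ring.
Qed.

Let L_flat s t : 0 <= s -> s <= t ->
  (forall u, s <= u <= t -> 0 < \sum_i Psi u i + L u) -> L t = L s.
Proof.
move=> s0 st H; apply/eqP; rewrite eq_le; apply/andP; split; last exact: L_nd.
have [st'|ts] := ltP s t; last first.
  by have -> : s = t by apply/eqP; rewrite eq_le st ts.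
have [p _] := push (T0 + t + 1).
have := p (fun=> 1) (T0 + s) (T0 + t); rewrite addr_ge0 // ltrD2l st' ltrDl ltr01.
rewrite dotp_const mul1r -L_diff subr_le0; apply => // u /andP[su ut].
apply: polar1; have -> : u = T0 + (u - T0) by rewrite addrC subrK.
have u0 : s <= u - T0 by rewrite lerBrDl ltW.
rewrite -sum_phi ?(le_trans s0) //; apply: H.
by rewrite u0 lerBlDl.
Qed.

Let L_left t e : 0 < t -> 0 < \sum_i Psi t i + L t -> 0 < e ->
  exists2 s, 0 <= s < t & L t - e < L s.
Proof.
move=> t0 pos e0.
have Tt : 0 < T0 + t by rewrite ltr_wpDl.
have [_ p] := push (T0 + t + 1).
have := p (fun=> 1) (T0 + t) Tt; rewrite ltrDl ltr01 => /(_ isT).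
rewrite sum_phi in pos; last exact: ltW.
move=> /(_ (polar1 pos)); rewrite dotp_const mul1r sumrB subr_le0 => jump.
have cv : \sum_j eta (T0 + u) j @[u --> t^'-] --> \sum_j left_limit eta (T0 + t) j.
  apply: cvg_sumr => j _; apply: (@cvg_left_shift _ (eta^~ j)).
  exact: cadlag_left.
have /near_leftP[d d0 H] : \forall u \near t^'-,
    \sum_j eta (T0 + t) j - e < \sum_j eta (T0 + u) j.
  by apply: cvgr_gt cv _ _; lra.
pose s := Num.max 0 (t - d / 2).
have st : s < t by rewrite gt_max t0 /= ltrBlDr ltrDl divr_gt0.
exists s; first by rewrite le_max lexx.
have : t - d < s < t.
  rewrite st andbT lt_max; apply/orP; right; rewrite ltrD2l ltrN2 gtr_pMr //.
  by rewrite invf_lt1 // ltr1n.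
by move=> /H; rewrite /L /eta0 !sumrB; lra.
Qed.

(** Chosen so that [beta j * C >= 1] for every [j]: then [beta j * C] times the variation of [eta]
    compensates every decrease of [eta j]. *)
Let C := \sum_j (beta j)^-1.

Let C_ge j : 1 <= beta j * C.
Proof.
rewrite -[leLHS](@mulfV _ (beta j)) ?gt_eqF // ler_pM2l // /C (bigD1 j) //=.
by rewrite lerDl sumr_ge0 // => k _; rewrite invr_ge0 ltW.
Qed.

Lemma reduced_SM_exists : exists phi', gps_SM bK Psi phi'.
Proof.
have [_ _ _ _ [v [_ vE _ _]]] := SP.
have eta_v s t j : 0 <= s -> s <= t -> `|eta t j - eta s j| <= v t - v s.
  move=> s0 st; apply: le_trans (total_variation_dist vE s0 st).
  exact: (norm_le_enorm (fun k => eta t k - eta s k)).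
(* [m] is the image under [pathK] of the increment of [eta] plus [beta M]. The terms in [M] cancel
   in [Psi - bK M + m], which is the image of [phi] at time [T0 + t] under [pathK], hence
   nonnegative. *)
pose M t := C * (v (T0 + t) - v T0).
pose a t j := eta0 t j + beta j * M t.
pose m t (i : rest S) := a t (val i) + bK i * \sum_(j in S) a t j.
have a_nd s t j : 0 <= s -> s <= t -> a s j <= a t j.
  move=> s0 st; rewrite /a /eta0 /M.
  have := eta_v (T0 + s) (T0 + t) j; rewrite addr_ge0 // lerD2l st => /(_ isT isT).
  rewrite ler_norml => /andP[+ _].
  have v0 : 0 <= v (T0 + t) - v (T0 + s).
    by rewrite subr_ge0; apply: cumulative_is_nondecreasing; rewrite lerD2l.
  by have := C_ge j; nra.
have a0 j : a 0 j = 0 by rewrite /a /eta0 /M addr0 !subrr !mulr0 addr0.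
have b0 := weightK_gt0 beta_gt0 S_proper.
have sumS t : \sum_(j in S) a t j =
    \sum_(j in S) eta0 t j + (\sum_(j in S) beta j) * M t.
  by rewrite big_split /= -mulr_suml.
apply: (@gps_SM_exists _ _ bK Psi m M L b0
  (weightK_sum1 beta_gt0 S_proper)) => //.
- by apply: cadlag_restart => //; exact: cadlag_pathK.
- move=> s t i s0 st; apply: lerD; first exact: a_nd.
  by rewrite ler_pM2l; [apply: ler_sum => j _; exact: a_nd|exact: b0].
- by move=> i; rewrite /m a0 big1 ?mulr0 ?addr0.
- by rewrite /M addr0 subrr mulr0.
- move=> t t0; apply: cvgM; first exact: cvg_cst.
  apply: cvgB; last exact: cvg_cst.
  by apply: cvg_right_shift; exact: cumulative_is_right_continuous.
- move=> t t0; apply: cvg_sumr => j _; apply: cvgB; last exact: cvg_cst.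
  apply: (@cvg_right_shift _ (eta^~ j)); apply: (proj1 eta_cadlag).
  exact: addr_ge0.
- move=> t t0.
  have -> : \sum_i m t i = \sum_j a t j.
    transitivity (\sum_(i : rest S) a t (val i) + \sum_(i : rest S) bK i * \sum_(j in S) a t j).
      exact: big_split.
    by rewrite -mulr_suml (weightK_sum1 beta_gt0 S_proper) mul1r (sum_restC S (a t)) addrC.
  have -> : \sum_j a t j = L t + \sum_j beta j * M t by exact: big_split.
  by rewrite -mulr_suml beta_sum1 mul1r addrK.
- move=> t i t0; rewrite (_ : _ + _ =
      phi (T0 + t) (val i) + bK i * \sum_(j in S) phi (T0 + t) j).
    by rewrite addr_ge0 ?phi_ge0 ?addr_ge0 // mulr_ge0 ?(ltW (b0 i)) //
      sumr_ge0 // => j _; rewrite phi_ge0 ?addr_ge0.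
  have -> : \sum_(j in S) phi (T0 + t) j =
      \sum_(j in S) psi (T0 + t) j - \sum_(j in S) psi T0 j + \sum_(j in S) eta0 t j.
    rewrite -sumrB -big_split /=; apply: eq_bigr => j jS.
    by have := phiS0 jS; rewrite !phiE ?addr_ge0 // /eta0; lra.
  rewrite /m sumS /Psi /restart /pathK /restrictK /a beta_bK -/bK.
  by rewrite !phiE ?addr_ge0 // /eta0; ring.
Qed.
End ReducedExistence.

Unset Implicit Arguments.

Theorem theorem5p6 (R : realType) (J : nat) (hJ : (2 <= J)%N)
    (beta : 'I_J -> R) (hbeta : forall i, 0 < beta i < 1)
    (hbeta1 : \sum_i beta i = 1)
    (psi : R -> 'I_J -> R) (hpsi : cadlag psi) (hpsi0 : orthant (psi 0))
    (phi : R -> 'I_J -> R) (hphi : gps_ESM beta psi phi)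
    (T0 T : R) (hT0 : 0 <= T0) (hT : T0 < T)
    (S : {set 'I_J}) (hS : S \proper [set: 'I_J]%SET)
    (hE : forall t, T0 <= t < T -> S \subset [set i | phi t i == 0]%SET) :
  (forall phi' : R -> rest S -> R,
     gps_ESM (weightK S beta)
       (restart T0 (restrictK S phi T0) (pathK S beta psi)) phi' ->
     forall t i, T0 <= t < T -> restrictK S phi t i = phi' (t - T0) i) /\
  (gps_SM_dom beta psi ->
   exists phi' : R -> rest S -> R,
     gps_SM (weightK S beta)
       (restart T0 (restrictK S phi T0) (pathK S beta psi)) phi' /\
     forall t i, T0 <= t < T -> restrictK S phi t i = phi' (t - T0) i).
Proof.
have b0 i : 0 < beta i by have /andP[] := hbeta i.
have bK0 := weightK_gt0 b0 hS; have bK1 := weightK_sum1 b0 hS.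
have phiS t : T0 <= t < T -> forall i, i \in S -> phi t i = 0.
  by move=> tT i iS; have /fintype.subsetP/(_ i iS) := hE t tT; rewrite inE => /eqP.
have [eta ESP] := hphi; have [cphi ceta phi0 H] := ESP.
have phiE t i : 0 <= t -> phi t i = psi t i + eta t i.
  by move=> t0; have [] := H t t0.
have phi_ge0 t : 0 <= t -> orthant (phi t) by move=> t0; have [] := H t t0.
have push := gps_ESP_pushes b0 hbeta1 T ESP.
have unique phi' eta' := @reduced_unique _ _ beta S b0 hbeta1 hS psi phi eta
  T0 T phi' eta' hT0 cphi ceta phiE phi_ge0 phiS push.
have restart0 i : restart T0 (restrictK S phi T0) (pathK S beta psi) 0 i =
    restrictK S phi T0 i by rewrite /restart addr0 subrr addr0.
split=> [phi' [eta' ESP']|[phi2 [eta2 SP2]]].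
  have [cphi' ceta' phi'0 H'] := ESP'.
  apply: (unique phi' eta') => //.
  - by move=> t i t0; have [] := H' t t0.
  - by move=> t t0; have [] := H' t t0.
  - by move=> i; rewrite phi'0.
  - exact: gps_ESP_pushes ESP'.
have [cphi2 ceta2 phi20 H2 _] := SP2.
(* [phi] is only given as a solution of the extended problem. It is identified with the Skorokhod
   solution [phi2] through the weak form, and [eta2] then supplies the bounded variation. *)
have phi2E : phi2 T0 = phi T0.
  apply/funext => i; apply: (gps_pushes_unique b0 hbeta1 (T := T)
    (eta1 := eta2) (eta2 := eta)) => //; last by rewrite hT0.
  - exact: le_lt_trans hT.
  - by move=> t /andP[t0 _]; have [] := H2 t t0.
  - by move=> t /andP[t0 _]; exact: phi_ge0.
  - by move=> t j /andP[t0 _]; have [-> _] := H2 t t0; rewrite phiE //; ring.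
  - by move=> j; rewrite phi20 phi0.
  - exact: gps_SP_pushes SP2.
have phi2S j : j \in S -> phi2 T0 j = 0.
  by move=> jS; rewrite phi2E phiS // lexx.
have := reduced_SM_exists b0 hbeta1 hS hpsi hT0 SP2 phi2S.
have -> : restrictK S phi2 T0 = restrictK S phi T0 by rewrite /restrictK phi2E.
move=> [phi' [eta' SP']]; exists phi'; split; first by exists eta'.
have [cphi' ceta' phi'0 H' _] := SP'.
apply: (unique phi' eta') => //.
- by move=> t i t0; have [] := H' t t0.
- by move=> t t0; have [] := H' t t0.
- by move=> i; rewrite phi'0.
- exact: gps_SP_pushes SP'.
Qed.
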